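(* Let $p\ge 3$ be a prime, let $N$ be a positive integer coprime to $p$, and let $\alpha\ge 0$ be an integer. (1) If $p\equiv 1 \pmod 3$, then $\overline{p}(3p^{6\alpha+5}N)\equiv 0 \pmod 3$ and $\overline{p}(3p^{18\alpha+17}N)\equiv 0 \pmod 9$. (2) If $p\equiv 2 \pmod 3$, then $\overline{p}(3p^{4\alpha+3}N)\equiv 0 \pmod 9$.
   Context: An overpartition of a nonnegative integer $n$ is a partition of $n$ in which the first occurrence of each distinct part may (or may not) be overlined; $\overline{p}(n)$ denotes the number of overpartitions of $n$ (with $\overline{p}(0)=1$). Equivalently, $\sum_{n\ge0}\overline{p}(n)q^n=\prod_{k\ge1}\frac{1+q^k}{1-q^k}$. *)

(* Defs.v *)
From mathcomp Require Import all_boot.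
Set Implicit Arguments. Unset Strict Implicit. Unset Printing Implicit Defensive.

(* Partitions of n into parts of size at most m, as nonincreasing lists of
   positive parts (largest part first); fuel bounds the recursion. *)
Fixpoint parts_le (fuel n m : nat) : seq (seq nat) :=
  match fuel with
  | 0 => if n == 0 then [:: [::]] else [::]
  | fuel'.+1 =>
      if n == 0 then [:: [::]]
      else flatten [seq [seq k :: l | l <- parts_le fuel' (n - k) k]
                   | k <- iota 1 (minn n m)]
  end.

Definition partitions (n : nat) : seq (seq nat) := parts_le n n n.

Fixpoint subseqs (s : seq nat) : seq (seq nat) :=
  if s is x :: s' then
    [seq x :: t | t <- subseqs s'] ++ subseqs s'
  else [:: [::]].

(* An overpartition of n is a partition l of n in which the first occurrence
   of each distinct part may or may not be overlined.  It is encoded as the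
   pair (l, T) where T is the list of the distinct parts whose first
   occurrence is overlined (a subsequence of undup l). *)
Definition overpartitions (n : nat) : seq (seq nat * seq nat) :=
  flatten [seq [seq (l, T) | T <- subseqs (undup l)] | l <- partitions n].

Definition overpartition_count (n : nat) : nat := size (overpartitions n).

Lemma overpartition_count_small :
  map overpartition_count (iota 0 6) = [:: 1; 2; 4; 8; 14; 24].
Proof. by []. Qed.

(* Main.v *)
(* Write [theta = sum_k X^(k^2)] and [r_k(n)] for the number of representations of [n] as a
   sum of [k] squares.  Gauss's identity says that [sum (-1)^n pbar(n) X^n] is the inverse of
   [theta].  Splitting [theta = A(X^3) + X B(X^3)] according to exponents mod 3 gives
   [sum (-1)^n pbar(3n) X^n = A^2 / (A^3 + X B^3)] with [A = theta(X^3)], and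
   [A (A^3 + X B^3) = theta^4] is a statement about sums of four squares.  Hence this series is
   [theta(X^3)^3 / theta^4], which is [theta^5] mod 9, that is
   [(-1)^n pbar(3n) = r_5(n) mod 9].

   For an odd prime [p] dividing [n], [r_5(p^2 n) = (p^3 + 1) r_5(n) - p^3 r_5(n / p^2)].  This
   comes from counting pairs (isotropic vector [a] of F_p^5, vector of norm [p^2 n] in the
   [p]-neighbour of Z^5 attached to [a]): each neighbour is a unimodular lattice of rank 5,
   hence isometric to Z^5 by Hermite's bound.  Therefore
   [r_5(p^(2k+1) N) = (1 + p^3 + ... + p^(3k)) r_5(p N)], and the factor vanishes modulo 3 or 9
   in each of the stated cases. *)

Require Import Defs.
From mathcomp Require Import all_boot all_order all_algebra zify ring.
Set Implicit Arguments. Unset Strict Implicit. Unset Printing Implicit Defensive.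
Import GRing.Theory Num.Theory Order.TTheory.

(** * Overpartitions and Gauss's identity *)

Definition overline_choices (l : seq nat) := 2 ^ size (undup l).
Definition over_count_le n m := \sum_(l <- parts_le n n m) overline_choices l.

Lemma size_subseqs s : size (subseqs s) = 2 ^ size s.
Proof.
by elim: s => //= x s IHs; rewrite size_cat size_map IHs addnn -mul2n expnS.
Qed.

Lemma overpartition_countE n : overpartition_count n = over_count_le n n.
Proof.
rewrite /overpartition_count /overpartitions size_flatten /shape -map_comp sumnE big_map.
by apply: eq_bigr => l _ /=; rewrite size_map size_subseqs.
Qed.

Lemma parts_le_fuel f g n m : n <= f -> n <= g -> parts_le f n m = parts_le g n m.
Proof.
elim: f g n m => [|f IHf] [|g] [|n] m //= nf ng.
congr flatten; apply/eq_in_map => k; rewrite mem_iota => /andP[k0 _].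
by congr map; apply: IHf; lia.
Qed.

Lemma parts_le_mem f n m l : l \in parts_le f n m -> all (leq^~ m) l.
Proof.
elim: f n m l => [|f IHf] [|n] m l //=; rewrite ?inE; try by move=> /eqP->.
move=> /flatten_mapP[k]; rewrite mem_iota => k_le /mapP[l' /IHf l'k ->] /=.
apply/andP; split; first lia.
by apply: sub_all l'k => i; lia.
Qed.

Lemma parts_leSr f n m : parts_le f.+1 n.+1 m.+1 = parts_le f.+1 n.+1 m ++
  if m <= n then [seq m.+1 :: l | l <- parts_le f (n - m) m.+1] else [::].
Proof.
rewrite /=; case: leqP => mn; last by rewrite cats0; congr (flatten (map _ (iota _ _))); lia.
have -> : minn n.+1 m.+1 = minn n.+1 m + 1 by lia.
rewrite iotaD map_cat flatten_cat /= cats0 subSS.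
by have -> : minn n.+1 m = m by lia.
Qed.

Local Arguments parts_le : simpl never.

(** Putting [m.+1] in front doubles the weight of a list in which it is new and keeps the weight of
    a list that already has it, so lists with parts at most [m] count twice. *)
Lemma sum_overline_choices_cons f n m :
  \sum_(l <- parts_le f n m.+1) overline_choices (m.+1 :: l) =
  \sum_(l <- parts_le f n m.+1) overline_choices l + \sum_(l <- parts_le f n m) overline_choices l.
Proof.
have cons_fresh f' n' : \sum_(l <- parts_le f' n' m) overline_choices (m.+1 :: l) =
    (\sum_(l <- parts_le f' n' m) overline_choices l).*2.
  rewrite -addnn -big_split /= big_seq [RHS]big_seq; apply: eq_bigr => l /parts_le_mem/allP l_le.
  rewrite /overline_choices /=; case: ifP => [/l_le|_] /=; first by rewrite ltnn.
  by rewrite expnS mul2n addnn.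
case: n f => [|n] [|f]; try by rewrite /parts_le /= ?big_nil ?big_seq1.
rewrite parts_leSr !big_cat /= cons_fresh -addnn.
rewrite [in RHS]addnAC; congr (_ + _).
case: leqP => _; last by rewrite !big_nil.
by rewrite !big_map; apply: eq_bigr => l _; rewrite /overline_choices /= inE eqxx.
Qed.

(** Coefficient form of [(1 - X^(m+1)) P_(m+1) = (1 + X^(m+1)) P_m], where [P_m] is the generating
    function for parts at most [m]. *)
Lemma over_count_leS n m : over_count_le n m.+1 = over_count_le n m +
  if m < n then over_count_le (n - m.+1) m.+1 + over_count_le (n - m.+1) m else 0.
Proof.
rewrite /over_count_le; case: n => [|n]; first by rewrite addn0.
rewrite parts_leSr big_cat /= ltnS subSS; congr (_ + _); case: leqP => mn; last by rewrite big_nil.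
by rewrite big_map sum_overline_choices_cons !(@parts_le_fuel n (n - m)) ?leq_subr.
Qed.

Lemma over_count_le0 n : over_count_le n 0 = (n == 0).
Proof. by rewrite /over_count_le /parts_le; case: n => [|n] /=; rewrite ?minn0 ?big_nil ?big_seq1. Qed.

Lemma over_count_le_ge n m : n <= m -> over_count_le n m = overpartition_count n.
Proof.
move=> /subnK <-; rewrite overpartition_countE; elim: (m - n) => // k IHk.
by rewrite addSn over_count_leS IHk ltnNge leq_addl addn0.
Qed.

Local Open Scope ring_scope.

(** Congruence modulo [X^M], which lets polynomials stand for truncated power series. *)
Definition coef_eq M (f g : {poly int}) := forall i, (i < M)%N -> f`_i = g`_i.

Lemma coef_eqM M f f' g g' : coef_eq M f f' -> coef_eq M g g' -> coef_eq M (f * g) (f' * g').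
Proof.
move=> ff' gg' i iM; rewrite !coefM; apply: eq_bigr => j _.
by rewrite ff' ?gg' //; case: j => /=; lia.
Qed.

(** A polynomial with constant term 1 is invertible as a power series: each coefficient of [D * f]
    is that of [f] plus multiples of earlier coefficients of [f]. *)
Lemma dvdz_coef_cancel (d : int) M (D f : {poly int}) : D`_0 = 1 ->
  (forall i, (i < M)%N -> (d %| (D * f)`_i)%Z) -> forall i, (i < M)%N -> (d %| f`_i)%Z.
Proof.
move=> D0 Df i; have [n] := ubnP i; elim: n i => // n IHn i ltin iM.
have := Df i iM; rewrite coefM big_ord_recl D0 mul1r subn0 rpredDr //.
apply: rpred_sum => j _; have ltji := ltn_ord j; apply: dvdz_mull; apply: IHn; rewrite /= /bump /=; lia.
Qed.

Lemma coef_eq_cancel M (D f g : {poly int}) : D`_0 = 1 ->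
  coef_eq M (D * f) (D * g) -> coef_eq M f g.
Proof.
move=> D0 Dfg i iM; apply/eqP; rewrite -subr_eq0 -coefB -dvd0z.
(* Divisibility by 0 is vanishing. *)
apply: (@dvdz_coef_cancel 0 M D (f - g)) => // j jM.
by rewrite mulrBr coefB Dfg // subrr.
Qed.

Definition plus_prod n : {poly int} := \prod_(k < n) (1 + 'X^(k.+1)).
Definition minus_prod s n : {poly int} := \prod_(s <= k < n) (1 - 'X^(k.+1)).

Lemma over_count_le_prod M m :
  coef_eq M (minus_prod 0 m * \poly_(n < M) (over_count_le n m)%:R) (plus_prod m).
Proof.
elim: m => [|m IHm] i iM.
  rewrite /minus_prod /plus_prod big_geq // big_ord0 mul1r coef_poly iM over_count_le0 coef1.
  by case: eqP.
rewrite /plus_prod big_ord_recr /=.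
rewrite /minus_prod big_nat_recr //= -mulrA; move: i iM.
rewrite -/(coef_eq M _ _) -/(minus_prod 0 m).
have step : coef_eq M ((1 - 'X^(m.+1)) * \poly_(n < M) (over_count_le n m.+1)%:R)
    ((1 + 'X^(m.+1)) * \poly_(n < M) (over_count_le n m)%:R).
  move=> i iM; rewrite mulrBl mulrDl !mul1r coefB coefD !coefXnM !coef_poly iM ltnS.
  rewrite over_count_leS; case: leqP => mi; first by rewrite addn0 oppr0.
  have -> : (i - m.+1 < M)%N by lia.
  by rewrite !natrD; ring.
move=> i iM; rewrite (coef_eqM (fun _ _ => erefl) step) //.
rewrite mulrCA mulrC; apply: (coef_eqM _ (fun _ _ => erefl)) iM.
exact: IHm.
Qed.

Definition theta_alt n : {poly int} := 1 + \sum_(k < n) (-1) ^+ k.+1 * 2%:R * 'X^(k.+1 ^ 2).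

Definition shanks_term n s : {poly int} :=
  (-1) ^+ s.+1 * 2%:R * plus_prod s * minus_prod s.+1 n * 'X^(s.+1 * n.+1).

(** Telescoping in [k], with the last summand as remainder. At [k = n] the remainder supplies the
    new square of [theta_alt] in the induction step of [shanks]. *)
Lemma shanks_partial n k : (k <= n)%N ->
  minus_prod 0 n.+1 + \sum_(s < k) shanks_term n.+1 s =
  (1 + 'X^(n.+1)) * (minus_prod 0 n + \sum_(s < k) shanks_term n s) +
  (-1) ^+ k.+1 * 2%:R * plus_prod k * minus_prod k n * 'X^(k.+1 * n.+1).
Proof.
elim: k => [_|k IHk kn].
  rewrite !big_ord0 /plus_prod big_ord0 /minus_prod big_nat_recr //= mul1n; ring.
rewrite !big_ord_recr /= addrA IHk ?(ltnW kn) //.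
have -> : minus_prod k n = (1 - 'X^(k.+1)) * minus_prod k.+1 n by rewrite /minus_prod big_ltn.
rewrite /shanks_term.
have -> : minus_prod k.+1 n.+1 = minus_prod k.+1 n * (1 - 'X^(n.+1)).
  by rewrite /minus_prod big_nat_recr.
have -> : plus_prod k.+1 = plus_prod k * (1 + 'X^(k.+1)) by rewrite /plus_prod big_ord_recr.
rewrite (_ : k.+1 * n.+2 = k.+1 * n.+1 + k.+1)%N; last lia.
rewrite (_ : k.+2 * n.+1 = k.+1 * n.+1 + n.+1)%N; last lia.
rewrite !exprD (exprS _ k.+1); ring.
Qed.

(* Shanks' finite form of Gauss's identity, with denominators cleared. *)
Lemma shanks n : plus_prod n * theta_alt n = minus_prod 0 n + \sum_(s < n) shanks_term n s.
Proof.
elim: n => [|n IHn].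
  by rewrite /plus_prod /theta_alt /minus_prod !big_ord0 big_geq // mul1r.
rewrite big_ord_recr /= addrA shanks_partial // -IHn /shanks_term /minus_prod.
rewrite !big_geq // /theta_alt big_ord_recr /=.
have -> : plus_prod n.+1 = plus_prod n * (1 + 'X^(n.+1)) by rewrite /plus_prod big_ord_recr.
rewrite (_ : n.+1 * n.+2 = n.+1 ^ 2 + n.+1)%N; last by rewrite -mulnn; lia.
rewrite exprD; ring.
Qed.

Lemma theta_alt_overpartition M :
  coef_eq M (theta_alt M * \poly_(n < M) (overpartition_count n)%:R) 1.
Proof.
have D0 : (plus_prod M)`_0 = 1.
  rewrite /plus_prod; elim: M => [|M IH]; first by rewrite big_ord0 coef1.
  by rewrite big_ord_recr /= coef0M IH coefD coef1 coefXn.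
apply: (coef_eq_cancel D0); rewrite mulrA mulr1 => i iM.
rewrite -(@over_count_le_prod M M i iM); move: i iM; apply: coef_eqM => i iM.
  (* The corrections in [shanks] carry [X^((s+1)(M+1))], so they vanish below degree [M]. *)
  rewrite shanks coefD coef_sum big1 ?addr0 // => s _.
  rewrite /shanks_term coefMXn ifT //; nia.
by rewrite !coef_poly iM over_count_le_ge // ltnW.
Qed.

(** * Representations by sums of squares *)

Definition norm2 k (x : 'rV[int]_k) : int := \sum_i x 0 i ^+ 2.

Definition centered M (j : 'I_(M.*2.+1)) : int := j%:Z - M%:Z.

Definition box k M : seq 'rV[int]_k :=
  [seq \row_i centered (f i) | f : {ffun 'I_k -> 'I_(M.*2.+1)}].

(** The box loses nothing, since an integer [z] satisfies [|z| <= z^2]. *)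
Definition reps k n : seq 'rV[int]_k := [seq x <- box k n | norm2 x == n%:Z].

Lemma box_uniq k M : uniq (box k M).
Proof.
rewrite map_inj_uniq ?enum_uniq // => f g /rowP fg; apply/ffunP => i.
have := fg i; rewrite !mxE /centered => /addIr[] /val_inj //.
Qed.

Lemma mem_box k M (x : 'rV[int]_k) : (forall i, `|x 0 i| <= M%:Z) -> x \in box k M.
Proof.
move=> xM; apply/mapP; exists [ffun i => inord (absz (x 0 i + M%:Z))]; first by rewrite mem_enum.
apply/rowP => i; rewrite mxE /centered ffunE inordK; move: (x 0 i) (xM i) => z; lia.
Qed.

Lemma norm2_coord k (x : 'rV[int]_k) i : `|x 0 i| <= norm2 x.
Proof.
rewrite /norm2 (bigD1 i) //=.
have : 0 <= \sum_(j | j != i) x 0 j ^+ 2 by apply: sumr_ge0 => j _; apply: sqr_ge0.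
by move: (\sum_(j | j != i) _) (x 0 i) => s z; nia.
Qed.

Lemma filter_box_perm k M n : (n <= M)%N ->
  perm_eq [seq x <- box k M | norm2 x == n%:Z] (reps k n).
Proof.
move=> nM; apply: uniq_perm; rewrite ?filter_uniq ?box_uniq // => x.
rewrite !mem_filter; case: eqP => //= xn.
by rewrite !mem_box // => i; have := norm2_coord x i; lia.
Qed.

Lemma reps_uniq k n : uniq (reps k n).
Proof. by rewrite filter_uniq ?box_uniq. Qed.

Lemma mem_reps k n (x : 'rV[int]_k) : (x \in reps k n) = (norm2 x == n%:Z).
Proof.
rewrite mem_filter; case: eqP => //= xn; apply: mem_box => i.
by rewrite -xn; apply: norm2_coord.
Qed.

Lemma size_eq_bij (T U : eqType) (s : seq T) (t : seq U) f g : uniq s -> uniq t ->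
  {in s, forall x, f x \in t /\ g (f x) = x} -> {in t, forall y, g y \in s /\ f (g y) = y} ->
  size s = size t.
Proof.
move=> us ut fP gP; rewrite -(size_map f); apply/perm_size/uniq_perm => //.
  by rewrite map_inj_in_uniq // => x y /fP[_ {2}<-] /fP[_ {2}<-] ->.
move=> y; apply/mapP/idP => [[x /fP[fx _] ->] //|/gP[gy fgy]]; by exists (g y).
Qed.

Definition theta M : {poly int} := \sum_(j < M.*2.+1) 'X^(`|centered j|%N ^ 2).

(** Expanding the product gives one monomial per vector of the box. The predicates on single
    coordinates serve the four-square identity, where one coordinate must be divisible by 3. *)
Lemma coef_prod_theta M k n (P : 'I_k -> pred int) : (n <= M)%N ->
  (\prod_(i < k) \sum_(j < M.*2.+1 | P i (centered j)) 'X^(`|centered j|%N ^ 2) : {poly int})`_n =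
  (count (fun x : 'rV[int]_k => [forall i, P i (x 0 i)]) (reps k n))%:R.
Proof.
move=> nM; rewrite bigA_distr_big_dep /= coef_sum -(permP (filter_box_perm k nM)).
rewrite count_filter count_map -sum1_count natr_sum big_enum_cond /= [LHS]big_mkcond [RHS]big_mkcond /=.
apply: eq_bigr => f _.
have -> : (f \in family (fun i j => P i (centered j))) =
    [forall i, P i ((\row_i0 centered (f i0) : 'rV_k) 0 i)].
  by apply/familyP/forallP => fP i; have := fP i; rewrite mxE.
case: forallP => _ //=.
rewrite -expr_sum coefXn.
have -> : norm2 (\row_i centered (f i)) = (\sum_i `|centered (f i)|%N ^ 2)%:Z.
  by rewrite /norm2 -natz natr_sum; apply: eq_bigr => i _; rewrite mxE natz; lia.
by rewrite eqz_nat eq_sym; case: eqP.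
Qed.

Lemma coef_theta_exp M k n : (n <= M)%N -> (theta M ^+ k)`_n = (size (reps k n))%:R.
Proof.
move=> nM; have -> : theta M ^+ k = \prod_(i < k) theta M by rewrite prodr_const card_ord.
rewrite (coef_prod_theta (fun=> xpredT)) //.
by rewrite -count_predT; congr (_%:R); apply: eq_count => x; apply/forallP.
Qed.


Lemma comp_polyNX (f : {poly int}) i : (f \Po - 'X)`_i = (-1) ^+ i * f`_i.
Proof.
have -> : f \Po - 'X = \poly_(j < size f) ((-1) ^+ j * f`_j).
  rewrite comp_polyE poly_def; apply: eq_bigr => j _.
  by rewrite -scaleN1r exprZn scalerA mulrC.
by rewrite coef_poly; case: ltnP => // /(nth_default 0) ->; rewrite mulr0.
Qed.

(** [k^2] and [k] have the same parity, so replacing [X] by [-X] removes the signs; the factor 2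
    accounts for [k] and [-k]. *)
Lemma theta_altN M : theta_alt M \Po - 'X = theta M.
Proof.
have -> : theta M = 1 + \sum_(k < M) 2%:R * 'X^(k.+1 ^ 2).
  rewrite /theta -(big_mkord xpredT (fun j => 'X^(absz (j%:Z - M%:Z) ^ 2))).
  rewrite (@big_cat_nat _ _ _ M) //=; [|lia..].
  have M_lt : (M < M.*2.+1)%N by lia.
  rewrite (big_ltn M_lt) subrr expr0.
  rewrite addrCA; congr (_ + _).
  under [RHS]eq_bigr do rewrite mulr_natl mulr2n.
  rewrite big_split /=; congr (_ + _).
    rewrite big_nat_rev /= big_mkord; apply: eq_bigr => i _; congr 'X^(_ ^ 2).
    by have := ltn_ord i; lia.
  rewrite -{1}[M.+1]add0n big_addn (_ : M.*2.+1 - M.+1 = M)%N; last lia.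
  by rewrite big_mkord; apply: eq_bigr => i _; congr 'X^(_ ^ 2); lia.
rewrite /theta_alt rmorphD /= comp_polyC; congr (_ + _).
rewrite rmorph_sum; apply: eq_bigr => k _ /=.
have -> : (-1 : {poly int}) ^+ k.+1 = ((-1) ^+ k.+1 : int)%:P by rewrite polyC_exp polyCN.
rewrite -mulrA -polyC_natr !mul_polyC !linearZ /= comp_Xn_poly -scaleN1r exprZn scalerA.
rewrite scalerA; congr (_ *: _).
rewrite -[_ ^+ k.+1]signr_odd -[_ ^+ (_ ^ 2)]signr_odd oddX /=.
by case: (odd k); rewrite /= ?expr0 ?expr1; ring.
Qed.

Definition signed_over M : {poly int} := \poly_(n < M) ((-1) ^+ n * (overpartition_count n)%:R).

Lemma theta_signed_over M : coef_eq M (theta M * signed_over M) 1.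
Proof.
have -> : signed_over M = \poly_(n < M) (overpartition_count n)%:R \Po - 'X.
  by apply/polyP => i; rewrite comp_polyNX !coef_poly; case: ifP => // _; rewrite mulr0.
move=> i iM; rewrite -theta_altN -comp_polyM comp_polyNX theta_alt_overpartition // coef1.
by case: i {iM} => //= i; rewrite mulr0.
Qed.

(** * Sums of four squares and the prime 3 *)

Definition vec4 (a b c d : int) : 'rV[int]_4 := \row_i [:: a; b; c; d]`_i.

Lemma vec4_eta (x : 'rV[int]_4) :
  exists a b c d, x = vec4 a b c d.
Proof.
exists (x 0 0), (x 0 1), (x 0 (inord 2)), (x 0 (inord 3)).
apply/rowP => i; rewrite mxE; case: i => -[|[|[|[|//]]]] i_lt /=; congr (x _ _);
  by apply: val_inj; rewrite /= ?inordK.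
Qed.

Lemma norm2_vec4 a b c d : norm2 (vec4 a b c d) = a ^+ 2 + b ^+ 2 + c ^+ 2 + d ^+ 2.
Proof. by rewrite /norm2 !big_ord_recr big_ord0 /= !mxE /= add0r. Qed.

(* The vectors [uH], where [H H^T = 3], are those whose class mod 3 lies in the tetracode, where
   every nonzero word has exactly one zero coordinate.  Moving that coordinate to the last place
   sends the four lines of the tetracode to the four isotropic lines with last coordinate 0. *)
Definition rot4 (w : int * int * int * int) : 'rV[int]_4 :=
  let: (a, b, c, d) := w in
  if (3 %| d)%Z then vec4 a b c d else if (3 %| c)%Z then vec4 a b d c
  else if (3 %| b)%Z then vec4 a d c b else vec4 d b c a.

(** On images of [rot4], congruences among the first three coordinates reveal which coordinate was
    moved to the last place. *)
Definition unrot4 (x : 'rV[int]_4) : int * int * int * int :=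
  let: (a, b, c, d) := (x 0 0, x 0 1, x 0 (inord 2), x 0 (inord 3)) in
  if (3 %| a - b)%Z then if (3 %| a - c)%Z then (a, b, c, d) else (d, b, c, a)
  else if (3 %| a - c)%Z then (a, b, d, c) else (a, d, c, b).

(** The map [x -> xH] followed by [rot4]. Here [H] is symmetric with [H^2 = 3], so [untriple4]
    applies the same [H] and divides by 3. *)
Definition triple4 (x : 'rV[int]_4) : 'rV[int]_4 :=
  let: (a, b, c, d) := (x 0 0, x 0 1, x 0 (inord 2), x 0 (inord 3)) in
  rot4 (a + b + c, a - b + d, a - c - d, b - c + d).

Definition untriple4 (x : 'rV[int]_4) : 'rV[int]_4 :=
  let: (a, b, c, d) := unrot4 x in
  vec4 ((a + b + c) %/ 3)%Z ((a - b + d) %/ 3)%Z ((a - c - d) %/ 3)%Z ((b - c + d) %/ 3)%Z.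

Lemma vec4_coords a b c d (x := vec4 a b c d) :
  (x 0 0 = a) * (x 0 1 = b) * (x 0 (inord 2) = c) * (x 0 (inord 3) = d).
Proof. by rewrite /x !mxE /= ?inordK. Qed.

Lemma sqr_mod3 (a : int) : (3 %| a)%Z /\ (3 %| a ^+ 2)%Z \/ ~~ (3 %| a)%Z /\ (3 %| a ^+ 2 - 1)%Z.
Proof.
have [q [r [-> [|[|]] ->]]] : exists q r, a = q * 3 + r /\ (r = 0 \/ r = 1 \/ r = 2).
  by exists (a %/ 3)%Z, (a %% 3)%Z; lia.
- left; rewrite (_ : _ ^+ 2 = 3 * (3 * q ^+ 2)); last ring.
  by move: (q ^+ 2) => t; lia.
- right; rewrite (_ : _ ^+ 2 - 1 = 3 * (3 * q ^+ 2 + 2 * q)); last ring.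
  by move: (q ^+ 2) => t; lia.
- right; rewrite (_ : _ ^+ 2 - 1 = 3 * (3 * q ^+ 2 + 4 * q + 1)); last ring.
  by move: (q ^+ 2) => t; lia.
Qed.

Lemma triple4P (x : 'rV[int]_4) :
  [/\ (3 %| triple4 x 0%R (inord 3))%Z, norm2 (triple4 x) = 3 * norm2 x & untriple4 (triple4 x) = x].
Proof.
have [a [b [c [d ->]]]] := vec4_eta x; rewrite norm2_vec4 /triple4 !vec4_coords /rot4.
case: ifP => h1; [|case: ifP => h2; [|case: ifP => h3]];
  rewrite /untriple4 /unrot4 !vec4_coords norm2_vec4.
all: split; [lia|ring|].
all: repeat (case: ifP => ?); try lia; congr vec4; lia.
Qed.

Lemma untriple4P (x : 'rV[int]_4) n : (3 %| x 0%R (inord 3))%Z -> norm2 x = 3 * n ->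
  norm2 (untriple4 x) = n /\ triple4 (untriple4 x) = x.
Proof.
have [a [b [c [d ->]]]] := vec4_eta x; rewrite norm2_vec4 !vec4_coords => d3 xn.
rewrite /untriple4 /unrot4 !vec4_coords.
(* Squares are 0 or 1 mod 3, so with [d] divisible by 3 either all or none of [a], [b], [c] are. *)
have abc3 : (3 %| a)%Z = (3 %| b)%Z /\ (3 %| a)%Z = (3 %| c)%Z.
  have [] := sqr_mod3 a; have [] := sqr_mod3 b; have [] := sqr_mod3 c; have [] := sqr_mod3 d;
  move: (a ^+ 2) (b ^+ 2) (c ^+ 2) (d ^+ 2) xn => ? ? ? ? ? [? ?] [? ?] [? ?] [? ?]; lia.
(* [H] is inverted once for any order of the coordinates; the four uses below are the four orders
   that [unrot4] can return. *)
have key e f g h : (3 %| e + f + g)%Z -> (3 %| e - f + h)%Z -> (3 %| e - g - h)%Z ->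
    (3 %| f - g + h)%Z -> e ^+ 2 + f ^+ 2 + g ^+ 2 + h ^+ 2 = 3 * n ->
    let y := vec4 ((e + f + g) %/ 3)%Z ((e - f + h) %/ 3)%Z ((e - g - h) %/ 3)%Z
      ((f - g + h) %/ 3)%Z in norm2 y = n /\ triple4 y = rot4 (e, f, g, h).
  move=> e1 e2 e3 e4 en y; rewrite /triple4 !vec4_coords norm2_vec4.
  set e' := ((e + f + g) %/ 3)%Z; set f' := ((e - f + h) %/ 3)%Z.
  set g' := ((e - g - h) %/ 3)%Z; set h' := ((f - g + h) %/ 3)%Z.
  have eE : e = e' + f' + g' by rewrite /e' /f' /g'; clear en; lia.
  have fE : f = e' - f' + h' by rewrite /e' /f' /h'; clear en; lia.
  have gE : g = e' - g' - h' by rewrite /e' /h' /g'; clear en; lia.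
  have hE : h = f' - g' + h' by rewrite /h' /f' /g'; clear en; lia.
  rewrite -eE -fE -gE -hE; split=> //; move: en; rewrite eE fE gE hE.
  move: e' f' g' h' {eE fE gE hE} => e' f' g' h' en.
  by apply: (@mulfI _ 3) => //; rewrite -en; ring.
case: ifP => h1; case: ifP => h2.
- have [|||||-> ->] := key a b c d; try (clear xn key; lia); first by [].
  by rewrite /rot4 d3.
- have [|||||-> ->] := key d b c a; try (clear xn key; lia); first by rewrite -xn; ring.
  by rewrite /rot4; split=> //; clear xn key; do 3 (case: ifP => ?; first lia).
- have [|||||-> ->] := key a b d c; try (clear xn key; lia); first by rewrite -xn; ring.
  by rewrite /rot4; split=> //; clear xn key; do 2 (case: ifP => ?; try lia).
- have [|||||-> ->] := key a d c b; try (clear xn key; lia); first by rewrite -xn; ring.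
  by rewrite /rot4; split=> //; clear xn key; do 3 (case: ifP => ?; try lia).
Qed.

(** The counting form of [A (A^3 + X B^3) = theta^4], compared at [X^n]. *)
Lemma size_reps4_triple n :
  count (fun x : 'rV[int]_4 => (3 %| x 0%R (inord 3))%Z) (reps 4 (3 * n)) = size (reps 4 n).
Proof.
rewrite -size_filter; symmetry.
apply: (@size_eq_bij _ _ _ _ triple4 untriple4); rewrite ?reps_uniq ?(filter_uniq _ (reps_uniq _ _)) //.
  move=> x; rewrite [_ \in reps 4 n]mem_reps mem_filter mem_reps => /eqP xn.
  by have [-> -> ->] := triple4P x; rewrite xn PoszM eqxx.
move=> x; rewrite [_ \in reps 4 n]mem_reps mem_filter mem_reps PoszM => /andP[x3 /eqP xn].
by have [-> ->] := untriple4P x3 xn; rewrite eqxx.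
Qed.

(** * Reduction modulo 9 to sums of five squares *)

Lemma coef_dissect (F G H : {poly int}) n (S := F \Po 'X^3 + 'X * (G \Po 'X^3) + 'X^2 * (H \Po 'X^3)) :
  [/\ S`_(3 * n) = F`_n, S`_(3 * n + 1) = G`_n & S`_(3 * n + 2) = H`_n].
Proof.
have E i : S`_i = (if (3 %| i)%N then F`_(i %/ 3) else 0) +
    (if (1 <= i)%N && (3 %| i.-1)%N then G`_(i.-1 %/ 3) else 0) +
    (if (2 <= i)%N && (3 %| i - 2)%N then H`_((i - 2) %/ 3) else 0).
  rewrite /S !coefD coefXM coefXnM !coef_comp_poly_Xn //.
  by case: i => [|[|i]] //=.
split; rewrite E; do 3![case: ifP => ?; try lia]; rewrite ?addr0 ?add0r; congr (_`_ _); lia.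
Qed.

(** Squares are 0 or 1 mod 3, so no exponent is 2 mod 3, and the exponents divisible by 3 come from
    multiples of 3. *)
Lemma theta_split M : exists B,
  \sum_(j < (3 * M).+1.*2.+1 | (3 %| centered j)%Z) 'X^(`|centered j|%N ^ 2) = (theta M \Po 'X^3) \Po 'X^3
  /\ theta (3 * M).+1 = ((theta M \Po 'X^3) \Po 'X^3) + 'X * (B \Po 'X^3).
Proof.
set a := \sum_(j | _) _.
have aE : a = (theta M \Po 'X^3) \Po 'X^3.
  (* Index [3 * m + 1] has centred value [3 * m + 1 - (3 * M + 1)], three times that of [m]. *)
  pose h (m : 'I_(M.*2.+1)) : 'I_((3 * M).+1.*2.+1) := inord (3 * m + 1).
  pose h' (j : 'I_((3 * M).+1.*2.+1)) : 'I_(M.*2.+1) := inord (j.-1 %/ 3).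
  have hE m : h m = (3 * m + 1)%N :> nat by rewrite /h inordK //; have := ltn_ord m; lia.
  rewrite /a (reindex_onto h h') /=; last first.
    move=> j; rewrite /centered => j3; apply: val_inj; rewrite /= hE /h'.
    have := ltn_ord j => j_lt; rewrite inordK; lia.
  rewrite /theta !rmorph_sum /=; apply: eq_big => [m|m _].
    rewrite /centered hE; apply/andP; split; first lia.
    apply/eqP/val_inj; rewrite /h' hE addn1 /= mulKn // inord_val //.
  rewrite !comp_Xn_poly -exprM comp_Xn_poly -exprM; congr 'X^_.
  rewrite /centered hE; set m' := m%:Z - M%:Z.
  rewrite (_ : _ - _ = 3 * m'); last by rewrite /m'; lia.
  by rewrite abszM expnMn; lia.
exists (\sum_(j < (3 * M).+1.*2.+1 | ~~ (3 %| centered j)%Z) 'X^((`|centered j|%N ^ 2).-1 %/ 3)).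
split=> //; rewrite -aE /theta (bigID (fun j => (3 %| centered j)%Z)) /=; congr (_ + _).
rewrite rmorph_sum mulr_sumr; apply: eq_bigr => j j3 /=.
rewrite comp_Xn_poly -exprM -exprS; congr 'X^_.
have [[]|[_]] := sqr_mod3 (centered j); first by rewrite (negPf j3).
move: (centered j) j3 => z; rewrite -abszX; move: (z ^+ 2) (sqr_ge0 z) => t; lia.
Qed.

(** Induction on the polynomial: [c^3 = c] mod 3 for integers, and the mixed terms of a cube are
    divisible by 3. *)
Lemma frobenius3 (f : {poly int}) : exists S, f \Po 'X^3 = f ^+ 3 + 3%:R * S.
Proof.
elim/poly_ind: f => [|f c [S IH]]; first by exists 0; rewrite comp_poly0 expr0n mulr0 addr0.
have [t ct] : exists t, c = c ^+ 3 + (t + t + t).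
  suff /divzK tE : (3 %| c - c ^+ 3)%Z.
    exists ((c - c ^+ 3) %/ 3)%Z; rewrite (_ : forall x : int, x + x + x = x * 3) => [|x]; last ring.
    by rewrite tE; ring.
  have [q [r [-> [|[|]] ->]]] : exists q r, c = q * 3 + r /\ (r = 0 \/ r = 1 \/ r = 2).
  - by exists (c %/ 3)%Z, (c %% 3)%Z; lia.
  - by rewrite (_ : _ - _ = (q - 9 * q ^+ 3) * 3) ?dvdz_mull //; ring.
  - by rewrite (_ : _ - _ = (- 2 * q - 9 * q ^+ 3 - 9 * q ^+ 2) * 3) ?dvdz_mull //; ring.
  - by rewrite (_ : _ - _ = (- 2 - 11 * q - 18 * q ^+ 2 - 9 * q ^+ 3) * 3) ?dvdz_mull //; ring.
exists (S * 'X^3 + t%:P - f ^+ 2 * 'X ^+ 2 * c%:P - f * 'X * c%:P ^+ 2).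
rewrite comp_polyD comp_polyM comp_polyX comp_polyC IH.
rewrite [in LHS]ct !polyCD polyC_exp; ring.
Qed.

Lemma coef_eq0M M (f g : {poly int}) : coef_eq M f 0 -> coef_eq M (g * f) 0.
Proof. by move=> f0; rewrite -(mulr0 g); apply: coef_eqM. Qed.

Lemma overpartition_3n_mod9 n :
  ((-1) ^+ n * (overpartition_count (3 * n))%:R = (size (reps 5 n))%:R %[mod 9])%Z.
Proof.
pose M := n.+1; have [B [aE TE]] := theta_split M.
set A := theta M \Po 'X^3 in aE TE; set T := theta _ in TE.
pose Q := signed_over (3 * M).+1.
pose Qr r : {poly int} := \poly_(i < M) Q`_(3 * i + r).
have Q_split : coef_eq (3 * M) (Qr 0%N \Po 'X^3 + 'X * (Qr 1%N \Po 'X^3) + 'X^2 * (Qr 2%N \Po 'X^3)) Q.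
  move=> i iM; have := coef_dissect (Qr 0%N) (Qr 1%N) (Qr 2%N) (i %/ 3).
  rewrite !coef_poly (_ : i %/ 3 < M)%N ?addn0; last lia.
  have : (i = 3 * (i %/ 3) \/ i = 3 * (i %/ 3) + 1 \/ i = 3 * (i %/ 3) + 2)%N by lia.
  by move: (i %/ 3)%N => q [|[|]] -> [].
have TQ : coef_eq (3 * M) (T * (Qr 0%N \Po 'X^3 + 'X * (Qr 1%N \Po 'X^3) + 'X^2 * (Qr 2%N \Po 'X^3))) 1.
  move=> i iM; rewrite (coef_eqM (fun _ _ => erefl) Q_split) //.
  by apply: theta_signed_over; lia.
rewrite TE in TQ.
have TQ3 : coef_eq (3 * M) ((A * Qr 0%N + 'X * B * Qr 2%N) \Po 'X^3 +
   'X * ((A * Qr 1%N + B * Qr 0%N) \Po 'X^3) + 'X^2 * ((A * Qr 2%N + B * Qr 1%N) \Po 'X^3)) 1.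
  move=> i iM; rewrite -TQ //; congr (polyseq _)`_ _.
  by rewrite !(comp_polyD, comp_polyM, comp_polyX); ring.
(* Comparing exponents mod 3 gives three linear equations for the parts [Qr r]. *)
have [E0 E1 E2] : [/\ coef_eq M (A * Qr 0%N + 'X * B * Qr 2%N - 1) 0,
    coef_eq M (A * Qr 1%N + B * Qr 0%N) 0 & coef_eq M (A * Qr 2%N + B * Qr 1%N) 0].
  split=> i iM; have [S0 S1 S2] := coef_dissect (A * Qr 0%N + 'X * B * Qr 2%N)
      (A * Qr 1%N + B * Qr 0%N) (A * Qr 2%N + B * Qr 1%N) i.
  - by rewrite coefB -S0 TQ3 ?coef1 ?coef0; [case: i {iM S0 S1 S2}|lia].
  - by rewrite -S1 TQ3 ?coef1 ?coef0; [rewrite addn1|lia].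
  - by rewrite -S2 TQ3 ?coef1 ?coef0; [rewrite addn2|lia].
(* The coefficient of [X^(3i)] in [T^3 A(X^3)] counts the representations of [3i] by four squares
   with last coordinate divisible by 3. The part of this product with exponents divisible by 3 comes
   from [A (A^3 + X B^3)]. *)
have A4 : coef_eq M (A * (A ^+ 3 + 'X * B ^+ 3)) (theta M ^+ 4).
  move=> i iM; rewrite coef_theta_exp ?(ltnW iM) // -size_reps4_triple.
  have [<- _ _] := coef_dissect (A * (A ^+ 3 + 'X * B ^+ 3)) (3%:R * A ^+ 3 * B)
    (3%:R * A ^+ 2 * B ^+ 2) i.
  pose P (k : 'I_4) (z : int) := (k == inord 3) ==> (3 %| z)%Z.
  have := @coef_prod_theta (3 * M).+1 4 (3 * i) P; rewrite (_ : 3 * i <= _)%N; last lia.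
  have -> : \prod_(k < 4) \sum_(j < (3 * M).+1.*2.+1 | P k (centered j)) 'X^(`|centered j|%N ^ 2)
      = T ^+ 3 * (A \Po 'X^3).
    rewrite (bigD1 (inord 3)) //= mulrC -aE /P eqxx; congr (_ * _).
    rewrite (eq_bigr (fun=> T)) => [|k /negPf k3]; last by apply: eq_bigl => j; rewrite k3.
    by rewrite prodr_const cardC1 card_ord.
  move=> /(_ isT) count_P.
  transitivity ((count (fun x : 'rV[int]_4 => [forall k, P k (x 0 k)]) (reps 4 (3 * i)))%:R : int).
    rewrite -count_P; congr (polyseq _)`_ _.
    by rewrite TE !(comp_polyD, comp_polyM, comp_polyX, rmorphXn) /= ?comp_polyX ?comp_Xn_poly; ring.
  congr (_%:R); apply: eq_count => x; apply/forallP/idP => [/(_ (inord 3))|x3 k].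
    by rewrite /P eqxx.
  by apply/implyP => /eqP ->.
have Q0A : coef_eq M (Qr 0%N * theta M ^+ 4) (A ^+ 3).
  move=> i iM; rewrite -(coef_eqM (fun _ _ => erefl) A4) //.
  apply/eqP; rewrite -subr_eq0 -coefB; apply/eqP.
  (* This combination eliminates [Qr 1] and [Qr 2]. *)
  rewrite (_ : _ - _ = A ^+ 3 * (A * Qr 0%N + 'X * B * Qr 2%N - 1) -
     'X * B * A ^+ 2 * (A * Qr 2%N + B * Qr 1%N) + 'X * B ^+ 2 * A * (A * Qr 1%N + B * Qr 0%N)).
    by rewrite coefD coefB !(coef_eq0M _ _ iM) // coef0.
  ring.
have [S AS] := frobenius3 (theta M); rewrite -/A in AS.
have t0 : (theta M ^+ 4)`_0 = 1.
  rewrite -horner_coef0 horner_exp horner_coef0 -theta_altN comp_polyNX mul1r.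
  rewrite coefD coef1 coef_sum big1 ?addr0 ?expr1n // => k _.
  by rewrite coefMXn.
have := @dvdz_coef_cancel 9 M (theta M ^+ 4) (Qr 0%N - theta M ^+ 5) t0.
(* [A = theta^3 + 3S] gives [A^3 = theta^9] mod 9, from which [theta^4] is then cancelled. *)
have H : forall i, (i < M)%N -> (9 %| (theta M ^+ 4 * (Qr 0%N - theta M ^+ 5))`_i)%Z.
  move=> i iM; rewrite mulrBr coefB mulrC Q0A // -coefB AS.
  rewrite (_ : _ - _ = 9%:R * (theta M ^+ 6 * S + 3%:R * theta M ^+ 3 * S ^+ 2 + 3%:R * S ^+ 3)).
    by rewrite -polyC_natr coefCM dvdz_mulr.
  ring.
move=> /(_ H n (ltnSn n)); rewrite coefB coef_theta_exp // coef_poly ltnSn addn0.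
rewrite /Q /signed_over coef_poly (_ : (3 * n < _)%N); last lia.
rewrite -eqz_mod_dvd => /eqP <-; congr (_ %% _)%Z; congr (_ * _).
by rewrite -[LHS]signr_odd -[RHS]signr_odd oddM.
Qed.

(** * Hermite's bound and unimodular lattices of rank at most 5 *)

Definition qform n (A : 'M[int]_n) (x : 'rV[int]_n) : int := (x *m A *m x^T) 0 0.
Definition posdef n (A : 'M[int]_n) := forall x, x != 0 -> 0 < qform A x.

Lemma qform_congr n (A R : 'M[int]_n) x : qform (R *m A *m R^T) x = qform A (x *m R).
Proof. by rewrite /qform trmx_mul !mulmxA. Qed.

Lemma qformZ n (A : 'M[int]_n) c x : qform A (c *: x) = c ^+ 2 * qform A x.
Proof. by rewrite /qform linearZ /= -!scalemxAl -scalemxAr !mxE expr2 mulrA. Qed.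

Lemma qform_delta n (A : 'M[int]_n.+1) : qform A (delta_mx 0 0) = A 0 0.
Proof. by rewrite /qform -rowE trmx_delta -colE !mxE. Qed.

Lemma row_mul_unit_eq0 n (R : 'M[int]_n) (x : 'rV[int]_n) : R \in unitmx -> (x *m R == 0) = (x == 0).
Proof.
move=> uR; apply/eqP/eqP => [xR|->]; last exact: mul0mx.
by rewrite -[x](mulmxK uR) xR mul0mx.
Qed.

Lemma congr_posdef n (A R : 'M[int]_n) : R \in unitmx -> posdef A -> posdef (R *m A *m R^T).
Proof. by move=> uR pA x x0; rewrite qform_congr; apply: pA; rewrite row_mul_unit_eq0. Qed.

Lemma congr_sym n (A R : 'M[int]_n) : A^T = A -> (R *m A *m R^T)^T = R *m A *m R^T.
Proof. by move=> sA; rewrite !trmx_mul trmxK sA mulmxA. Qed.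

Lemma congr_det n (A R : 'M[int]_n) : R \in unitmx -> \det (R *m A *m R^T) = \det A.
Proof.
rewrite unitmxE !det_mulmx det_tr => uR.
have : \det R ^+ 2 = 1 by case/orP: uR => /eqP->.
by rewrite expr2 => dR; rewrite mulrAC dR mul1r.
Qed.

(** Smith normal form of a single row: a vector is a multiple of a primitive one, which extends to a
    basis. *)
Lemma row_in_basis n (x : 'rV[int]_n.+1) :
  exists R : 'M[int]_n.+1, exists2 d : int, R \in unitmx & x = d *: row 0 R.
Proof.
have [L _ [R uR [d _ ->]]] := int_Smith_normal_form x.
exists R, (L 0 0 * d`_0) => //.
rewrite rowE scalemxAl; congr (_ *m R); apply/rowP => j.
by rewrite !mxE big_ord1 !mxE eqxx /= -val_eqE /= eq_sym -mulr_natr; case: eqP; rewrite ?mulr1 ?mulr0.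
Qed.

Section Schur.
Variables (n : nat) (a : int) (b : 'rV[int]_n) (C : 'M[int]_n).
Let A : 'M[int]_(1 + n) := block_mx a%:M b b^T C.
(** [a] times the usual Schur complement, which keeps the entries integral. *)
Definition schur : 'M[int]_n := a *: C - b^T *m b.

Lemma mx11D (x y : 'M[int]_1) : (x + y) 0 0 = x 0 0 + y 0 0.
Proof. by rewrite mxE. Qed.

Lemma mx11N (x : 'M[int]_1) : (- x) 0 0 = - x 0 0.
Proof. by rewrite mxE. Qed.

Lemma mx11Z c (x : 'M[int]_1) : (c *: x) 0 0 = c * x 0 0.
Proof. by rewrite mxE. Qed.

Lemma mx11M (x y : 'M[int]_1) : (x *m y) 0 0 = x 0 0 * y 0 0.
Proof. by rewrite mxE big_ord1. Qed.

Definition mx11E := (mx11D, mx11N, mx11Z, mx11M).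

(** Completing the square in the first coordinate. *)
Lemma qform_schur x0 (w : 'rV[int]_n) :
  a * qform A (row_mx x0%:M w) = (a * x0 + (b *m w^T) 0 0) ^+ 2 + qform schur w.
Proof.
have wb : (w *m b^T) 0 0 = (b *m w^T) 0 0 by rewrite -[w *m b^T]trmxK trmx_mul trmxK mxE.
have -> : qform schur w = a * qform C w - ((b *m w^T) 0 0) ^+ 2.
  rewrite /qform /schur mulmxBr mulmxBl -scalemxAr -scalemxAl !mulmxA -(mulmxA _ b) !mx11E.
  by rewrite wb expr2.
rewrite /qform /A mul_row_block tr_row_mx mul_row_col !mulmxDl tr_scalar_mx.
rewrite -!scalar_mxM !mul_scalar_mx !mul_mx_scalar -!scalemxAl !mx11E wb [_%:M 0 0]mxE /=.
by set s := (b *m w^T) 0 0; set q := (w *m C *m w^T) 0 0; ring.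
Qed.

Lemma det_schur : a * \det schur = a ^+ n * \det A.
Proof.
have E : block_mx 1%:M 0 (- b^T) a%:M *m A = block_mx a%:M b 0 schur.
  rewrite /A mulmx_block !mul0mx !addr0 !mul1mx; congr block_mx.
    by rewrite mul_mx_scalar mul_scalar_mx scalerN addNr.
  by rewrite mulNmx mul_scalar_mx addrC.
have := congr1 determinant E.
by rewrite det_mulmx det_lblock det_ublock !det_scalar !expr1 mul1r => ->.
Qed.

Lemma schur_sym : C^T = C -> schur^T = schur.
Proof. by move=> sC; rewrite /schur linearB linearZ /= trmx_mul trmxK sC. Qed.

Lemma schur_posdef : 0 < a -> posdef A -> posdef schur.
Proof.
move=> a0 pA y y0.
(* For this vector the square in [qform_schur] vanishes. *)
have v0 : row_mx (- (b *m y^T) 0 0)%:M (a *: y) != 0 :> 'rV_(1 + n).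
  rewrite row_mx_eq0 negb_and orbC; apply/orP; left; apply: contraNneq y0 => /matrixP ay.
  apply/eqP/matrixP => i j; have /eqP := ay i j.
  by rewrite !mxE mulf_eq0 (gt_eqF a0) => /eqP.
have := qform_schur (- (b *m y^T) 0 0) (a *: y).
rewrite linearZ /= -scalemxAr mx11Z qformZ.
have := pA _ v0; set q := qform A _; set s := (b *m _) 0 0; set h := qform _ y.
rewrite (_ : a * - s + a * s = 0); last ring.
rewrite expr0n add0r /= => q0 E.
have : 0 < a ^+ 2 * h by rewrite -E mulr_gt0.
by rewrite pmulr_rgt0 // exprn_gt0.
Qed.
End Schur.

Lemma sym_block n (A : 'M[int]_(1 + n)) : A^T = A ->
  exists (a : int) b, exists2 C, C^T = C & A = block_mx a%:M b b^T C /\ a = A 0 0.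
Proof.
move=> sA; exists (A 0 0), (ursubmx A), (drsubmx A); first by rewrite trmx_drsub sA.
split=> //; rewrite -{1}[A]submxK; congr block_mx; last by rewrite trmx_ursub sA.
by rewrite [ulsubmx A]mx11_scalar !mxE; congr (A _ _)%:M; apply: val_inj.
Qed.

(** [-x] is [s / a] rounded to a nearest integer. *)
Lemma nearest_multiple (a s : int) : 0 < a -> exists x : int, 4 * (a * x + s) ^+ 2 <= a ^+ 2.
Proof.
move=> a0; exists (- ((2 * s + a) %/ (2 * a))%Z).
have := divz_eq (2 * s + a) (2 * a).
have a2 : 2 * a != 0 by lia.
have := ltz_pmod (2 * s + a) (_ : 0 < 2 * a); have := modz_ge0 (2 * s + a) a2.
move: (_ %/ _)%Z (_ %% _)%Z => q r r0 r2 E.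
have {}r2 : r < 2 * a by apply: r2; lia.
have -> : a * - q + s = s - a * q by ring.
have : 2 * (s - a * q) = r - a by nia.
move: (s - a * q) => t tE; have -> : 4 * t ^+ 2 = (r - a) ^+ 2 by rewrite -tE; ring.
nia.
Qed.

(* Hermite's bound: [min A <= (4/3)^(n/2) (det A)^(1/(n+1))] in dimension [n+1]. *)
Lemma hermite n (A : 'M[int]_n.+1) : A^T = A -> posdef A ->
  exists2 x : 'rV[int]_n.+1, x != 0 & qform A x ^+ n.+1 * 3 ^+ 'C(n.+1, 2) <= 4 ^+ 'C(n.+1, 2) * \det A.
Proof.
elim: n A => [|n IHn] A sA pA.
  exists 1; first exact: oner_neq0.
  rewrite expr1 !expr0 mulr1 mul1r /qform mul1mx trmx1 mulmx1.
  by rewrite [A]mx11_scalar det_scalar1 mxE.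
have : exists x, (x : 'rV[int]_n.+2) != 0.
  by exists (delta_mx 0 0); apply/eqP => /rowP/(_ 0); rewrite !mxE.
(* Descent on the value of the form: a nonzero vector either leads to the bound or to a nonzero
   vector of smaller value. *)
case=> x; have [m] := ubnP `|qform A x|%N; elim: m x => // m IHm x lexm x0.
have [R [d uR xE]] := row_in_basis x.
have d0 : d != 0 by apply: contraNneq x0 => d0; rewrite xE d0 scale0r.
have r0 : row 0 R != 0 by apply: contraNneq x0 => r0; rewrite xE r0 scaler0.
have aq : qform A (row 0 R) <= qform A x.
  rewrite xE qformZ; apply: ler_peMl; first exact: ltW (pA _ r0).
  by rewrite -gtz0_ge1 exprn_even_gt0 /= ?d0.
pose A1 : 'M_(1 + n.+1) := R *m A *m R^T.
have [a [b [C sC [A1E aE]]]] : exists (a : int) b, exists2 C, C^T = C & A1 = block_mx a%:M b b^T C /\ a = A1 0 0.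
  by apply: sym_block; apply: congr_sym.
have {}aE : a = qform A (row 0 R).
  by rewrite aE rowE -qform_congr qform_delta.
have a0 : 0 < a by rewrite aE; apply: pA.
have pA1 : posdef (block_mx a%:M b b^T C) by rewrite -A1E; apply: congr_posdef.
(* [y] is short for the Schur form by induction; [t] lifts it with square term at most [a^2 / 4] in
   [qform_schur]. *)
have [y y0 yS] := IHn _ (schur_sym a b sC) (schur_posdef a0 pA1).
have [t tP] := nearest_multiple ((b *m y^T) 0 0) a0.
have := qform_schur a b C t y; set h := qform (schur _ _ _) y in yS *; rewrite -A1E qform_congr.
set v := _ *m R => vE.
have w0 : row_mx t%:M y != 0 :> 'rV[int]_(1 + n.+1) by rewrite row_mx_eq0 negb_and y0 orbT.
have v0 : v != 0 by rewrite row_mul_unit_eq0.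
have [lt_va|le_av] := ltP (qform A v) a.
  by apply: (IHm v) => //; have := pA _ v0; move: (qform A v) lt_va; rewrite aE => q; lia.
exists (row 0 R) => //; rewrite -aE.
(* In this case [a^2 <= a q(v) <= a^2 / 4 + h]. *)
have ah : 3 * a ^+ 2 <= 4 * h.
  have : a * a <= a * qform A v by rewrite ler_pM2l.
  rewrite vE; move: (_ ^+ 2) tP => u; lia.
have detS : \det (schur a b C) = a ^+ n * \det A.
  have a_neq0 : a != 0 by rewrite gt_eqF.
  apply: (mulfI a_neq0).
  by rewrite det_schur -A1E congr_det // exprS mulrA.
have h0 : 0 <= h by lia.
(* [3 a^2 <= 4 h] raised to the power [n+1]; chained with [yS] it gives the bound once [a^n] is
   cancelled. *)
have key : 3 ^+ n.+1 * (a ^+ n * a ^+ n.+2) <= 4 ^+ n.+1 * h ^+ n.+1.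
  have -> : a ^+ n * a ^+ n.+2 = (a ^+ 2) ^+ n.+1 by rewrite -exprD -exprM; congr (a ^+ _); lia.
  by rewrite -!exprMn_comm ?lerXn2r // ?nnegrE; try exact: mulrC; lia.
rewrite detS in yS; have -> : 'C(n.+2, 2) = (n.+1 + 'C(n.+1, 2))%N by rewrite binS bin1 addnC.
rewrite !(exprD _ n.+1) -(@ler_pM2l _ (a ^+ n)) ?exprn_gt0 //.
have P3 k : 0 < 3 ^+ k :> int by rewrite exprn_gt0.
have P4 k : 0 < 4 ^+ k :> int by rewrite exprn_gt0.
have arith (u X Y w U H W D : int) : 0 <= w -> 0 <= U -> u * (X * Y) <= U * H ->
    H * w <= W * (X * D) -> X * (Y * (u * w)) <= X * (U * W * D).
  move=> w_ge0 U0 /(ler_wpM2r w_ge0) L1 /(ler_wpM2l U0) L2.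
  rewrite (_ : X * (Y * _) = u * (X * Y) * w); last ring.
  rewrite (_ : X * (U * _ * _) = U * (W * (X * D))); last ring.
  by apply: le_trans L1 _; rewrite -mulrA.
by apply: arith key yS; apply: ltW.
Qed.

(** A minimum of at least 2 would contradict Hermite's bound, since [2^m 3^C > 4^C] with
    [C = m (m - 1) / 2] for [m <= 5]. The inequality fails at [m = 6]. *)
Lemma unimodular_norm1 n (A : 'M[int]_n.+1) : (n < 5)%N -> A^T = A -> posdef A -> \det A = 1 ->
  exists x, qform A x = 1.
Proof.
move=> n5 sA pA dA; have [x x0 hx] := hermite sA pA; exists x; move: (pA x x0) hx.
rewrite dA mulr1; move: (qform A x) => a a0 ha; apply/eqP; rewrite eq_le [1 <= a]a0 andbT leNgt.
apply/negP => a1; move: ha; apply/negP; rewrite -ltNge.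
apply: (@lt_le_trans _ _ (2 ^+ n.+1 * 3 ^+ 'C(n.+1, 2))).
  by case: n n5 {A sA pA dA x x0} => [|[|[|[|[|//]]]]].
by rewrite ler_pM2r ?exprn_gt0 // lerXn2r // nnegrE; lia.
Qed.

(** A vector of norm 1 splits off: for [a = 1] the form [schur] is the Gram matrix of its orthogonal
    complement, again unimodular. *)
Lemma unimodular_std n (A : 'M[int]_n) : (n <= 5)%N -> A^T = A -> posdef A -> \det A = 1 ->
  exists V : 'M[int]_n, V *m A *m V^T = 1%:M.
Proof.
elim: n A => [|n IHn] A n5 sA pA dA; first by exists 1%:M; apply/matrixP => -[].
have [x x1] := unimodular_norm1 n5 sA pA dA.
have [R [d uR xE]] := row_in_basis x.
have r1 : qform A (row 0 R) = 1.
  have r0 : row 0 R != 0.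
    by apply: contra_eq_neq x1 => r0; rewrite xE r0 scaler0 /qform !mul0mx mxE.
  move: x1 (pA _ r0); rewrite xE qformZ; move: (qform _ _) => q dq q0.
  have : 0 < d ^+ 2 by rewrite -(pmulr_lgt0 _ q0) dq.
  move: (d ^+ 2) dq => e; nia.
pose A1 : 'M_(1 + n) := R *m A *m R^T.
have [a [b [C sC [A1E aE]]]] := sym_block (congr_sym R sA : A1^T = A1).
have {}aE : a = 1 by rewrite aE -qform_delta qform_congr -rowE.
rewrite aE in A1E.
have pA1 : posdef (block_mx 1%:M b b^T C) by rewrite -A1E; apply: congr_posdef.
have dS : \det (schur 1 b C) = 1.
  by rewrite -[LHS]mul1r det_schur expr1n mul1r -A1E congr_det.
have [V VS] := IHn _ (ltnW n5) (schur_sym 1 b sC) (schur_posdef ltr01 pA1) dS.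
pose E : 'M[int]_(1 + n) := block_mx 1%:M 0 (- (V *m b^T)) V.
have EA : E *m block_mx 1%:M b b^T C *m E^T = 1%:M :> 'M[int]_(1 + n).
  rewrite /E tr_block_mx mulmx_block !mul1mx !mul0mx !addr0 mulmx1 addNr.
  rewrite mulmx_block trmx0 trmx1 !mulmx1 !mulmx0 !mul0mx !addr0 !add0r.
  rewrite linearN /= trmx_mul trmxK mulmxN mul1mx addNr scalar_mx_block; congr block_mx.
  by rewrite -VS /schur scale1r mulmxBr mulNmx addrC !mulmxA.
by exists (E *m R); rewrite -EA -A1E trmx_mul !mulmxA.
Qed.

(** * Neighbours of Z^5 *)

Definition dot n (x y : 'rV[int]_n) : int := (x *m y^T) 0 0.

Lemma dotC n (x y : 'rV[int]_n) : dot x y = dot y x.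
Proof. by rewrite /dot -[x *m _]trmxK trmx_mul trmxK mxE. Qed.

Lemma dotDr n (x y z : 'rV[int]_n) : dot x (y + z) = dot x y + dot x z.
Proof. by rewrite /dot linearD mulmxDr mx11D. Qed.

Lemma dotZr n c (x y : 'rV[int]_n) : dot x (c *: y) = c * dot x y.
Proof. by rewrite /dot linearZ -scalemxAr mx11Z. Qed.

Lemma dotDl n (x y z : 'rV[int]_n) : dot (y + z) x = dot y x + dot z x.
Proof. by rewrite dotC dotDr !(dotC x). Qed.

Lemma dotZl n c (x y : 'rV[int]_n) : dot (c *: y) x = c * dot y x.
Proof. by rewrite dotC dotZr (dotC x). Qed.

Lemma dot_delta n (x : 'rV[int]_n) i : dot x (delta_mx 0 i) = x 0 i.
Proof. by rewrite /dot trmx_delta -colE mxE. Qed.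

Lemma norm2_dot n (x : 'rV[int]_n) : norm2 x = dot x x.
Proof. by rewrite /norm2 /dot mxE; apply: eq_bigr => i _; rewrite mxE expr2. Qed.

Lemma scalemx_int_inj m n (c : int) (X Y : 'M[int]_(m, n)) : c != 0 -> c *: X = c *: Y -> X = Y.
Proof.
move=> c0 /matrixP XY; apply/matrixP => i j; have := XY i j.
by rewrite !mxE => /(mulfI c0).
Qed.

(** [T] and [G] have the same row lattice: in the Smith form of [G] the rows of the diagonal factor
    after the first [n] are zero. *)
Lemma lattice_basis m n (G : 'M[int]_(n + m, n)) :
  exists T : 'M[int]_n, (exists P, T = P *m G) /\ (exists Q, G = Q *m T).
Proof.
have [L uL [R _ [d _ GE]]] := int_Smith_normal_form G.
set D := \matrix_(i, j) _ in GE.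
have D0 : D = col_mx (usubmx D) 0.
  rewrite -[LHS]vsubmxK; congr col_mx; apply/matrixP => i j; rewrite !mxE /=.
  by rewrite (_ : _ == _ = false) //; apply/eqP => /= ij; have := ltn_ord j; lia.
exists (usubmx D *m R); split.
  exists (usubmx (invmx L)); rewrite !mul_usub_mx; congr usubmx.
  by rewrite GE -!mulmxA mulKmx.
exists (lsubmx L); rewrite {1}GE {1}D0 -[L in LHS]hsubmxK mul_row_col mulmx0 addr0.
by rewrite mulmxA.
Qed.

Section Neighbour.
Variables (q : int) (v : 'rV[int]_5) (i0 : 'I_5).
Hypotheses (q_gt0 : 0 < q) (vv : exists m, dot v v = q ^+ 2 * m).
Hypothesis (vi0 : exists s r, s * v 0 i0 + r * q = 1).

(** [q] times the neighbour [{z | q divides v.z} + Z v/q] of Z^5. The scaling keeps vectors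
    integral, and integrality of products becomes divisibility by [q^2]. *)
Definition neighbour (y : 'rV[int]_5) :=
  (exists k z, y = k *: v + q *: z) /\ (exists m, dot v y = q ^+ 2 * m).

Let q_neq0 : q != 0. Proof. by rewrite gt_eqF. Qed.
Let q2_neq0 : q ^+ 2 != 0. Proof. by rewrite expf_neq0. Qed.

Lemma neighbour_dotz k z : neighbour (k *: v + q *: z) -> exists m, dot v z = q * m.
Proof.
case=> _ [m]; rewrite dotDr !dotZr; have [m0 ->] := vv => E.
exists (m - k * m0).
apply: (mulfI q_neq0); move/(congr1 (fun e => e - k * (q ^+ 2 * m0))): E; rewrite addrAC subrr add0r => ->.
ring.
Qed.

Lemma neighbour0 : neighbour 0.
Proof.
split; first by exists 0, 0; rewrite scale0r scaler0 addr0.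
by exists 0; rewrite -(scale0r (v)) dotZr mul0r mulr0.
Qed.

Lemma neighbourD x y : neighbour x -> neighbour y -> neighbour (x + y).
Proof.
move=> [[k [z ->]] [m mE]] [[k' [z' ->]] [m' mE']]; split.
  by exists (k + k'), (z + z'); rewrite scalerDl scalerDr addrACA.
by exists (m + m'); rewrite dotDr mE mE' mulrDr.
Qed.

Lemma neighbourZ c y : neighbour y -> neighbour (c *: y).
Proof.
move=> [[k [z ->]] [m mE]]; split.
  by exists (c * k), (c *: z); rewrite scalerDr !scalerA (mulrC q).
by exists (c * m); rewrite dotZr mE mulrCA.
Qed.

Lemma neighbour_mul m (G : 'M[int]_(m, 5)) : (forall i, neighbour (row i G)) -> forall u, neighbour (u *m G).
Proof.
move=> nG u; rewrite mulmx_sum_row; apply: (big_ind neighbour).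
- exact: neighbour0.
- exact: neighbourD.
- by move=> i _; apply: neighbourZ.
Qed.

Lemma neighbour_integral x y : neighbour x -> neighbour y -> exists m, dot x y = q ^+ 2 * m.
Proof.
move=> nx [[k' [z' yE]] [m mE]]; have [[k [z xE]] _] := nx.
rewrite xE in nx; have [n nE] := neighbour_dotz nx.
exists (k * m + k' * n + dot z z'); rewrite xE dotDl !dotZl mE {1}yE dotDr !dotZr (dotC z v) nE; ring.
Qed.

Lemma neighbour_q2 z : neighbour (q ^+ 2 *: z).
Proof.
split; last by exists (dot v z); rewrite dotZr.
by exists 0, (q *: z); rewrite scale0r add0r scalerA.
Qed.

Lemma neighbour_v : neighbour v.
Proof. by split=> //; exists 1, 0; rewrite scale1r scaler0 addr0. Qed.

Lemma neighbour_orth j : neighbour (q *: (v 0 i0 *: delta_mx 0 j - v 0 j *: delta_mx 0 i0)).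
Proof.
split; first by exists 0, (v 0 i0 *: delta_mx 0 j - v 0 j *: delta_mx 0 i0); rewrite scale0r add0r.
exists 0; rewrite dotZr -[- _]scaleN1r dotDr !dotZr !dot_delta; ring.
Qed.

Lemma neighbour_self_dual y : (forall x, neighbour x -> exists m, dot y x = q ^+ 2 * m) -> neighbour y.
Proof.
move=> dual; split; last by have [m mE] := dual _ neighbour_v; exists m; rewrite dotC.
have [s [r sr]] := vi0.
(* Pairing with [neighbour_orth] shows that [y] is proportional to [v] mod [q]; as [s] inverts
   [v 0 i0], the factor is [s * y 0 i0]. *)
have /fin_all_exists[f fE] j : exists m, v 0 i0 * y 0 j - v 0 j * y 0 i0 = q * m.
  have [m mE] := dual _ (neighbour_orth j); exists m; apply: (mulfI q_neq0).
  by rewrite mulrA -expr2 -mE dotZr -[- (v 0 j *: _)]scaleN1r dotDr !dotZr !dot_delta mulN1r.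
exists (s * y 0 i0), (\row_j (s * f j + r * y 0 j)); apply/rowP => j; rewrite !mxE.
rewrite mulrDr (mulrCA q) -fE -{1}[y 0 j]mul1r -sr; ring.
Qed.

(** The block [q^2] comes first so that [usubmx] extracts its coefficients in a basis. *)
Definition neighbour_gens : 'M[int]_(5 + (1 + 5), 5) :=
  col_mx (q ^+ 2)%:M (col_mx v (q *: (v 0 i0 *: 1%:M - v^T *m delta_mx 0 i0))).

Lemma neighbour_gensP y : neighbour y <-> exists u, y = u *m neighbour_gens.
Proof.
split=> [ny|[u ->]]; last first.
  apply: neighbour_mul => i; rewrite /neighbour_gens.
  case: (split_ordP i) => {i} i ->; rewrite ?rowKu ?rowKd.
    rewrite (_ : row i _ = q ^+ 2 *: delta_mx 0 i); first exact: neighbour_q2.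
    by rewrite -scalemx1 linearZ /= row1.
  case: (split_ordP i) => {i} i ->; rewrite ?rowKu ?rowKd.
    by rewrite row_id; exact: neighbour_v.
  rewrite (_ : row i _ = q *: (v 0 i0 *: delta_mx 0 i - v 0 i *: delta_mx 0 i0)); first exact: neighbour_orth.
  rewrite linearZ linearB linearZ /= row1 row_mul; congr (_ *: (_ - _)).
  by rewrite [row i v^T]mx11_scalar mul_scalar_mx !mxE.
have [[k [z yE]] _] := ny; rewrite yE in ny *.
have [m mE] := neighbour_dotz ny; have [s [r sr]] := vi0.
(* From [q z = (s v_i0 + r q) q z]; the term [s q (v.z) e_i0] subtracted by the third block returns
   in the first through [v.z = q m]. *)
exists (row_mx (s * m *: delta_mx 0 i0 + r *: z) (row_mx k%:M (s *: z))).
rewrite /neighbour_gens !mul_row_col mul_mx_scalar mul_scalar_mx -scalemxAl -scalemxAr.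
rewrite mulmxBr -scalemxAr mulmx1 mulmxA [z *m v^T]mx11_scalar -/(dot z v) dotC mE mul_scalar_mx.
rewrite [RHS]addrCA; congr (_ + _); rewrite -{1}[z]scale1r -sr.
by apply/rowP => j; rewrite !mxE; ring.
Qed.

(* The neighbour lattice, rescaled by [1/q], is unimodular of rank 5, hence isometric to Z^5. *)
Lemma neighbour_basis : exists2 B : 'M[int]_5, B *m B^T = (q ^+ 2)%:M &
  forall y, neighbour y <-> exists u, y = u *m B.
Proof.
have [T [[P TP] [Q GQ]]] := lattice_basis neighbour_gens.
have nT y : neighbour y <-> exists u, y = u *m T.
  rewrite neighbour_gensP; split=> -[u ->]; first by exists (u *m Q); rewrite GQ mulmxA.
  by exists (u *m P); rewrite TP mulmxA.
pose C := usubmx Q.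
have CT : C *m T = (q ^+ 2)%:M by rewrite mul_usub_mx -GQ col_mxKu.
(* With the adjugate of [X], a one-sided inverse up to [q^2] becomes two-sided. *)
have swap (X Y : 'M[int]_5) : X *m Y = (q ^+ 2)%:M -> Y *m X = (q ^+ 2)%:M.
  move=> XY; have dX : \det X != 0.
    have /eqP := congr1 determinant XY; rewrite det_mulmx det_scalar.
    by apply: contraTneq => ->; rewrite mul0r eq_sym expf_neq0.
  apply: (scalemx_int_inj dX); rewrite -!mul_scalar_mx -!mul_adj_mx -!mulmxA; congr (_ *m _).
  by rewrite mulmxA XY -scalar_mxC.
have TC := swap _ _ CT.
have rowT i : neighbour (row i T) by apply/nT; exists (delta_mx 0 i); rewrite -rowE.
have /fin_all_exists[fA fAE] (i : 'I_5) : exists f : 'I_5 -> int, forall j, (T *m T^T) i j = q ^+ 2 * f j.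
  have /fin_all_exists[f fE] (j : 'I_5) : exists m, (T *m T^T) i j = q ^+ 2 * m; last by exists f.
  have [m mE] := neighbour_integral (rowT i) (rowT j); exists m.
  by rewrite -mE /dot !mxE; apply: eq_bigr => k _; rewrite !mxE.
pose A := \matrix_(i, j) fA i j.
have TA : T *m T^T = q ^+ 2 *: A by apply/matrixP => i j; rewrite fAE !mxE.
have sA : A^T = A.
  by apply: (scalemx_int_inj q2_neq0); rewrite -linearZ /= -TA trmx_mul trmxK.
(* The rows of [C^T] pair with the lattice in multiples of [q^2], so by self-duality they lie in it;
   this makes [A] invertible over the integers. *)
have /fin_all_exists[fW fWE] (j : 'I_5) : exists u, row j C^T = u *m T.
  apply/nT; apply: neighbour_self_dual => x /nT[u ->].
  exists (u 0 j); rewrite /dot trmx_mul mulmxA -row_mul -trmx_mul TC tr_scalar_mx.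
  by rewrite -scalemx1 linearZ /= row1 -scalemxAl -rowE !mxE.
have CW : C^T = (\matrix_j fW j) *m T.
  by apply/row_matrixP => j; rewrite fWE row_mul rowK.
have dA : \det A = 1.
  have WA : (\matrix_j fW j) *m A = 1%:M.
    apply: (scalemx_int_inj q2_neq0); rewrite scalemxAr -TA mulmxA -CW -trmx_mul TC tr_scalar_mx.
    by rewrite scalemx1.
  have dW : \det (\matrix_j fW j) * \det A = 1 by rewrite -det_mulmx WA det1.
  have dA0 : 0 <= \det A.
    have : 0 <= \det (T *m T^T) by rewrite det_mulmx det_tr -expr2 sqr_ge0.
    by rewrite TA detZ pmulr_rge0 // !exprn_gt0.
  by have /orP[/eqP //|/eqP dAN] := intUnitRing.unitzPl dW; rewrite dAN in dA0.
have pA : posdef A.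
  move=> x x0; rewrite -(@pmulr_rgt0 _ (q ^+ 2)) ?exprn_gt0 //.
  have -> : q ^+ 2 * qform A x = norm2 (x *m T).
    by rewrite norm2_dot /dot trmx_mul /qform -mx11Z scalemxAl scalemxAr -TA !mulmxA.
  have xT0 : x *m T != 0.
    apply: contraNneq x0 => xT0; apply/eqP/(scalemx_int_inj q2_neq0).
    by rewrite scaler0 -mul_mx_scalar -TC mulmxA xT0 mul0mx.
  rewrite lt_def sumr_ge0 => [|i _]; last exact: sqr_ge0.
  rewrite andbT psumr_neq0 => [|i _]; last exact: sqr_ge0.
  apply: contraNT xT0 => /hasPn no_i; apply/eqP/rowP => i; apply/eqP.
  by have := no_i i (mem_index_enum i); rewrite /= exprn_even_gt0 //= negbK [X in _ -> _ == X]mxE.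
have [V VA] := unimodular_std (leqnn 5) sA pA dA.
pose B := V *m T.
have BB : B *m B^T = (q ^+ 2)%:M.
  by rewrite trmx_mul mulmxA -(mulmxA V) TA -scalemxAr -scalemxAl VA scalemx1.
have rowB i : neighbour (row i B) by apply/nT; exists (row i V); rewrite -row_mul.
exists B => // y; split=> [ny|[u ->]]; last exact: neighbour_mul.
(* The products of [y] with the rows of [B], divided by [q^2], are its coordinates. *)
have /fin_all_exists[c cE] (i : 'I_5) : exists m, dot y (row i B) = q ^+ 2 * m.
  exact: neighbour_integral ny (rowB i).
exists (\row_i c i); apply: (scalemx_int_inj q2_neq0).
rewrite -mul_mx_scalar -(swap _ _ BB) mulmxA scalemxAl; congr (_ *m _).
apply/rowP => i; rewrite [RHS]mxE [X in _ = _ * X]mxE -cE /dot [LHS]mxE [RHS]mxE.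
by apply: eq_bigr => k _; rewrite !mxE.
Qed.
End Neighbour.

(** * Isotropic vectors over F_p *)

Section Conic.
Variable p : nat.
Hypotheses (p_pr : prime p) (p_gt2 : (2 < p)%N).
Let F := 'F_p.

Lemma card_F : #|F| = p.
Proof. exact: card_Fp. Qed.

Lemma two_neq0 : 2 != 0 :> F.
Proof. by rewrite -[2]/(2%:R) -(dvdn_pcharf (pchar_Fp p_pr)) gtnNdvd. Qed.

(** Pigeonhole: the squares and their reflections [c - s] each fill more than half of the field. *)
Lemma sum_two_squares (c : F) : exists s t, s ^+ 2 + t ^+ 2 = c.
Proof.
pose A := [set s ^+ 2 | s : F].
have A_large : (p < #|A| * 2)%N.
  suff: (p <= #|A| * 2)%N.
    have : odd p by case: (even_prime p_pr) p_gt2 => [->|].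
    lia.
  (* The flag separates [s] from [-s], so each square is hit at most twice. *)
  pose f (s : F) := ((val s <= val (- s)%R)%N, s ^+ 2).
  have f_inj : injective f.
    move=> s t st; have /eqP : s ^+ 2 = t ^+ 2 := congr1 snd st.
    rewrite eqf_sqr => /orP[/eqP //|/eqP sE].
    have : (val s <= val (- s)%R)%N = (val t <= val (- t)%R)%N := congr1 fst st.
    by rewrite sE opprK => le_eq; apply: val_inj; move: (val t) (val (- t)) le_eq => i j; lia.
  have -> : (#|A| * 2 = #|setX [set: bool] A|)%N by rewrite cardsX cardsT card_bool mulnC.
  rewrite -{1}card_F -(card_imset _ f_inj).
  by apply/subset_leq_card/subsetP => _ /imsetP[s _ ->]; apply/setXP; split; [exact: in_setT|exact: imset_f].
pose B := [set c - s | s in A].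
have cardB : #|B| = #|A| by apply: card_imset => x y /addrI /oppr_inj.
have : ~~ [disjoint A & B].
  apply: contraTN A_large => dAB; have := subset_leq_card (subsetT (A :|: B)).
  by rewrite cardsU disjoint_setI0 // cards0 cardsT card_F cardB; lia.
case/pred0Pn => x /= /andP[/imsetP[s _ ->]] /imsetP[_ /imsetP[t _ ->] /eqP].
by rewrite eq_sym subr_eq => /eqP; exists s, t.
Qed.

(** Translations along [g] permute the fibres of [tau] on [P] transitively, so all [p] fibres have
    equal size. *)
Lemma card_slice (V : finLmodType F) (P : pred V) (g : V) (tau : V -> F) :
  (forall a t, P a -> P (a + t *: g)) -> (forall a t, P a -> tau (a + t *: g) = tau a + t) ->
  #|[set a | P a]| = (p * #|[set a | P a & tau a == 0%R]|)%N.
Proof.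
move=> Pg tau_g.
transitivity (\sum_(t : F) #|[set a | P a & tau a == 0%R]|)%N; last by rewrite sum_nat_const card_F.
rewrite -sum1_card (partition_big tau xpredT) //=.
apply: eq_bigr => t _; rewrite sum1dep_card.
have inj : injective (fun a : V => a + t *: g) by move=> a b /addIr.
rewrite -[RHS](card_imset _ inj); apply: eq_card => a; rewrite !inE.
apply/andP/imsetP => [[Pa /eqP ta]|[b]]; last first.
  by rewrite !inE => /andP[Pb /eqP tb] ->; rewrite Pg // tau_g // tb add0r.
exists (a + (- t) *: g); last by rewrite scaleNr subrK.
by rewrite !inE Pg // tau_g // ta subrr eqxx.
Qed.

Definition dotF n (a b : 'rV[F]_n) : F := (a *m b^T) 0 0.

Lemma dotFC n (x y : 'rV[F]_n) : dotF x y = dotF y x.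
Proof. by rewrite /dotF -[x *m _]trmxK trmx_mul trmxK mxE. Qed.

Lemma dotFDr n (x y z : 'rV[F]_n) : dotF x (y + z) = dotF x y + dotF x z.
Proof. by rewrite /dotF linearD mulmxDr mxE. Qed.

Lemma dotFZr n c (x y : 'rV[F]_n) : dotF x (c *: y) = c * dotF x y.
Proof. by rewrite /dotF linearZ -scalemxAr mxE. Qed.

Lemma dotFDl n (x y z : 'rV[F]_n) : dotF (y + z) x = dotF y x + dotF z x.
Proof. by rewrite dotFC dotFDr !(dotFC x). Qed.

Lemma dotFZl n c (x y : 'rV[F]_n) : dotF (c *: y) x = c * dotF y x.
Proof. by rewrite dotFC dotFZr (dotFC x). Qed.

Lemma dotF_delta n (x : 'rV[F]_n) i : dotF x (delta_mx 0 i) = x 0 i.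
Proof. by rewrite /dotF trmx_delta -colE mxE. Qed.

Let o0 : 'I_5 := inord 0.
Let o1 : 'I_5 := inord 1.
Let o2 : 'I_5 := inord 2.
Let o3 : 'I_5 := inord 3.
Let o4 : 'I_5 := inord 4.
Definition sqnorm4 (a : 'rV[F]_5) := a 0 o0 ^+ 2 + a 0 o1 ^+ 2 + a 0 o2 ^+ 2 + a 0 o3 ^+ 2.
(** Multiplication by [s + t i] on the coordinate pairs (0, 1) and (2, 3), with the last coordinate
    fixed. *)
Definition similitude (s t : F) (a : 'rV[F]_5) : 'rV[F]_5 :=
  \row_i [:: s * a 0 o0 - t * a 0 o1; t * a 0 o0 + s * a 0 o1;
             s * a 0 o2 - t * a 0 o3; t * a 0 o2 + s * a 0 o3; a 0 o4]`_i.

Lemma similitude_coord s t a (b := similitude s t a) :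
  (b 0 o0 = s * a 0 o0 - t * a 0 o1) * (b 0 o1 = t * a 0 o0 + s * a 0 o1) *
  (b 0 o2 = s * a 0 o2 - t * a 0 o3) * (b 0 o3 = t * a 0 o2 + s * a 0 o3) * (b 0 o4 = a 0 o4).
Proof. by rewrite /b !mxE !inordK. Qed.

Lemma row5P (a b : 'rV[F]_5) : a 0 o0 = b 0 o0 -> a 0 o1 = b 0 o1 -> a 0 o2 = b 0 o2 ->
  a 0 o3 = b 0 o3 -> a 0 o4 = b 0 o4 -> a = b.
Proof.
move=> e0 e1 e2 e3 e4; apply/rowP => i; rewrite -(inord_val i).
by case: i => -[|[|[|[|[|//]]]]] /=.
Qed.

Lemma dotF5 a : dotF a a = sqnorm4 a + a 0 o4 ^+ 2.
Proof.
rewrite /dotF mxE !big_ord_recr big_ord0 /= add0r !mxE /sqnorm4 !expr2.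
by congr (_ + _ + _ + _ + _); congr (a _ _ * a _ _); apply: val_inj; rewrite /= inordK.
Qed.

Lemma sqnorm4_similitude s t a : sqnorm4 (similitude s t a) = (s ^+ 2 + t ^+ 2) * sqnorm4 a.
Proof. by rewrite /sqnorm4 !similitude_coord; ring. Qed.

Lemma similitudeK s t a : similitude s (- t) (similitude s t a) =
  similitude (s ^+ 2 + t ^+ 2) 0 a.
Proof. by apply: row5P; rewrite !similitude_coord; ring. Qed.

(** The parameters may vary with the last coordinate because it is preserved; conjugation undoes the
    map up to the nonzero factor [s^2 + t^2]. *)
Lemma similitude_inj_in (s t : F -> F) : (forall x, s x ^+ 2 + t x ^+ 2 != 0) ->
  injective (fun a : 'rV[F]_5 => similitude (s (a 0 o4)) (t (a 0 o4)) a).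
Proof.
move=> st a b ab; have := congr1 (fun a : 'rV[F]_5 => a 0 o4) ab; rewrite /= !similitude_coord => ab4.
have := congr1 (similitude (s (a 0 o4)) (- t (a 0 o4))) ab; rewrite /= {3 4}ab4 -ab4 !similitudeK.
set c := _ + _; have c0 : c != 0 by apply: st.
move=> cab; apply: row5P => //; apply: (mulfI c0).
- by have := congr1 (fun a : 'rV[F]_5 => a 0 o0) cab; rewrite /= !similitude_coord !mul0r !subr0.
- by have := congr1 (fun a : 'rV[F]_5 => a 0 o1) cab; rewrite /= !similitude_coord !mul0r !add0r.
- by have := congr1 (fun a : 'rV[F]_5 => a 0 o2) cab; rewrite /= !similitude_coord !mul0r !subr0.
- by have := congr1 (fun a : 'rV[F]_5 => a 0 o3) cab; rewrite /= !similitude_coord !mul0r !add0r.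
Qed.

(* Every nonzero scalar is the factor of a similitude of the sum of four squares, so the
   isotropic cone is in bijection with the graph of [sqnorm4]. *)
Lemma card_isotropic : #|[set a : 'rV[F]_5 | dotF a a == 0]| = (p ^ 4)%N.
Proof.
pose Y := [set a : 'rV[F]_5 | a 0 o4 - sqnorm4 a == 0].
have cardY : #|Y| = (p ^ 4)%N.
  apply/eqP; rewrite -(eqn_pmul2l (prime_gt0 p_pr)) -expnS.
  have /= := @card_slice 'rV[F]_5 xpredT (delta_mx 0 o4) (fun a => a 0 o4 - sqnorm4 a) (fun _ _ _ => isT).
  move=> /(_ _)<-; last first.
    move=> a t _; rewrite /sqnorm4 !mxE !eqxx /= !mulr1.
    have neq4 k : (k < 4)%N -> ((inord k : 'I_5) == o4) = false.
      by move=> k4; apply/negbTE; rewrite -val_eqE /= !inordK; lia.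
    rewrite (neq4 0%N isT : (o0 == o4) = false) (neq4 1%N isT : (o1 == o4) = false).
    rewrite (neq4 2%N isT : (o2 == o4) = false) (neq4 3%N isT : (o3 == o4) = false).
    by rewrite !mulr0 !addr0 addrAC.
  by rewrite (_ : [set _ | _] = [set: 'rV[F]_5]) ?cardsT ?card_mx ?card_F // mul1n.
have /fin_all_exists[s /fin_all_exists[t st]] c : exists s t, s ^+ 2 + t ^+ 2 = c := sum_two_squares c.
have card_le (X Z : {set 'rV[F]_5}) (c : F -> F) : (forall x, c x != 0) ->
    (forall a, a \in X -> forall s t, s ^+ 2 + t ^+ 2 = c (a 0 o4) -> similitude s t a \in Z) ->
    (#|X| <= #|Z|)%N.
  move=> c0 XZ.
  have inj : injective (fun a : 'rV[F]_5 => similitude (s (c (a 0 o4))) (t (c (a 0 o4))) a).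
    by apply: (@similitude_inj_in (s \o c) (t \o c)) => x /=; rewrite st.
  rewrite -(card_imset _ inj); apply/subset_leq_card/subsetP => _ /imsetP[a aX ->].
  exact: XZ.
rewrite -cardY; apply/eqP; rewrite eqn_leq; apply/andP; split.
  (* On the cone [sqnorm4] is [-x^2], with [x] the last coordinate, and the factor [-1/x] turns it
     into [x]. At [x = 0] both sets require [sqnorm4 = 0]. The factor [-x] serves the opposite
     inequality. *)
  apply: (card_le _ _ (fun x => if x == 0 then 1 else - x^-1)) => [x|a].
    by have [_|x0] := eqVneq x 0; rewrite ?oner_neq0 // oppr_eq0 invr_eq0.
  rewrite /Y inE dotF5 addr_eq0 => /eqP aE s' t' stE; rewrite inE sqnorm4_similitude stE aE !similitude_coord.
  have [->|x0] := eqVneq (a 0 o4) 0; first by rewrite expr0n oppr0 mulr0 subr0.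
  by rewrite mulrNN expr2 mulKf // subrr.
apply: (card_le _ _ (fun x => if x == 0 then 1 else - x)) => [x|a].
  by have [_|x0] := eqVneq x 0; rewrite ?oner_neq0 // oppr_eq0.
rewrite /Y inE subr_eq0 => /eqP aE s' t' stE; rewrite inE dotF5 sqnorm4_similitude stE -aE !similitude_coord.
have [->|x0] := eqVneq (a 0 o4) 0; first by rewrite expr0n mulr0 addr0.
by rewrite mulNr expr2 addNr.
Qed.

(** When [a] is not orthogonal to [z], the norm of [a + t z] is affine in [t] with nonzero slope, so
    one such vector in [p] is isotropic. Removing these [p^4 - p^3] vectors from the cone leaves
    [p^3]. *)
Lemma card_isotropic_orth (z : 'rV[F]_5) : z != 0 -> dotF z z = 0 ->
  #|[set a | (dotF a a == 0) && (dotF a z == 0)]| = (p ^ 3)%N.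
Proof.
move=> z0 zz; have [i zi] : exists i, z 0 i != 0.
  apply/existsP; apply: contraNT z0; rewrite negb_exists => /forallP no_i.
  by apply/eqP/rowP => i; rewrite mxE; apply/eqP; have := no_i i; rewrite negbK.
have p0 := prime_gt0 p_pr.
have orth : #|[set a | dotF a z == 0]| = (p ^ 4)%N.
  apply/eqP; rewrite -(eqn_pmul2l p0) -expnS.
  rewrite (_ : [set a | _] = [set a | xpredT a & dotF a z / z 0 i == 0]); last first.
    by apply/setP => a; rewrite !inE mulf_eq0 invr_eq0 (negPf zi) orbF.
  rewrite -(@card_slice 'rV[F]_5 xpredT (delta_mx 0 i)) //; last first.
    by move=> a t _; rewrite dotFDl dotFZl (dotFC (delta_mx 0 i)) dotF_delta mulrDl mulfK.
  by rewrite (_ : [set _ | _] = [set: 'rV[F]_5]) ?cardsT ?card_mx ?card_F // mul1n.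
have nonorth : #|[set a | dotF a z != 0]| = (p * #|[set a | (dotF a a == 0%R) && (dotF a z != 0%R)]|)%N.
  rewrite (@card_slice 'rV[F]_5 _ z (fun a => dotF a a / (2 * dotF a z))).
  - congr (_ * #|pred_of_set _|)%N; apply/setP => a; rewrite !inE andbC.
    case: (boolP (dotF a z != 0)) => [az|]; rewrite ?andbF // !andbT.
    by rewrite mulf_eq0 invr_eq0 mulf_eq0 (negPf two_neq0) (negPf az) !orbF.
  - by move=> a t; rewrite dotFDl dotFZl zz mulr0 addr0.
  move=> a t az; rewrite !dotFDl !dotFDr !dotFZl !dotFZr zz !mulr0 !addr0 (dotFC z a).
  by field; rewrite two_neq0 az.
have total : (#|[set a | dotF a z == 0%R]| + #|[set a | dotF a z != 0%R]| = p ^ 5)%N.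
  transitivity #|{: 'rV[F]_5}|; last by rewrite card_mx card_F mul1n.
  rewrite -(cardC [set a | dotF a z == 0]); congr (_ + _)%N; apply: eq_card => a.
  by rewrite !inE.
have split : (#|[set a | (dotF a a == 0%R) && (dotF a z == 0%R)]| +
    #|[set a | (dotF a a == 0%R) && (dotF a z != 0%R)]| = p ^ 4)%N.
  rewrite -card_isotropic -[RHS](cardsID [set a | dotF a z == 0]); congr (_ + _)%N; apply: eq_card => a.
    by rewrite !inE.
  by rewrite !inE andbC.
move: split; rewrite orth nonorth in total.
move: total; rewrite !expnS expn0 !muln1; move: #|_| #|_| => u w; nia.
Qed.
End Conic.

(** * The Hecke relation for sums of five squares *)

Lemma sum_const_count (T : Type) (s : seq T) (P : pred T) c : (\sum_(y <- s | P y) c = count P s * c)%N.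
Proof. by rewrite big_const_seq iter_addn addn0 mulnC. Qed.

Section Hecke.
Variable p : nat.
Hypotheses (p_pr : prime p) (p_gt2 : (2 < p)%N).
Let F := 'F_p.

Lemma intr_Fp_eq0 (z : int) : ((z%:~R : F) == 0) = (p%:Z %| z)%Z.
Proof.
rewrite dvdzE /= (dvdn_pcharf (pchar_Fp p_pr)); case: z => n //=.
by rewrite NegzE mulrNz oppr_eq0.
Qed.

Lemma intr_Fp_dvd (z : int) : (z%:~R : F) = 0 -> exists m, z = p%:Z * m.
Proof. by move=> /eqP; rewrite intr_Fp_eq0 => /dvdzP[m ->]; exists m; rewrite mulrC. Qed.

Lemma p_Fp : p%:Z%:~R = 0 :> F.
Proof. by apply/eqP; rewrite intr_Fp_eq0. Qed.

Lemma intr_Fp_surj (c : F) : exists z : int, z%:~R = c.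
Proof. by exists (val c)%:Z; rewrite -pmulrn natr_Zp. Qed.

Definition redp n (x : 'rV[int]_n) : 'rV[F]_n := map_mx intr x.

Lemma redpD n (x y : 'rV[int]_n) : redp (x + y) = redp x + redp y.
Proof. exact: map_mxD. Qed.

Lemma redpZ n c (x : 'rV[int]_n) : redp (c *: x) = c%:~R *: redp x.
Proof. exact: map_mxZ. Qed.

Lemma dotF_redp n (x y : 'rV[int]_n) : dotF (redp x) (redp y) = (dot x y)%:~R.
Proof. by rewrite /dotF /dot map_trmx -map_mxM mxE. Qed.

Lemma redp_surj n (a : 'rV[F]_n) : exists x, redp x = a.
Proof.
have /fin_all_exists[f fE] i : exists z : int, z%:~R = a 0 i := intr_Fp_surj (a 0 i).
by exists (\row_i f i); apply/rowP => i; rewrite !mxE fE.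
Qed.

Lemma redp_eq0 n (x : 'rV[int]_n) : redp x = 0 -> exists z, x = p%:Z *: z.
Proof.
move=> /rowP x0; have /fin_all_exists[f fE] i : exists m, x 0 i = p%:Z * m.
  by apply: intr_Fp_dvd; have := x0 i; rewrite !mxE.
by exists (\row_i f i); apply/rowP => i; rewrite !mxE fE.
Qed.

Lemma redp_p n (x : 'rV[int]_n) : redp (p%:Z *: x) = 0.
Proof. by rewrite redpZ p_Fp scale0r. Qed.

Let p_neq0 : p%:Z != 0.
Proof. by have := prime_gt0 p_pr; lia. Qed.

Lemma two_Fp_neq0 : (2 : int)%:~R != 0 :> F.
Proof. exact: two_neq0. Qed.

(** Hensel lifting: adding [p t e_i] changes the norm by [2 p t v_i] mod [p^2], and [v_i] is a unit
    mod [p]. *)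
Lemma isotropic_lift (a : 'rV[F]_5) : a != 0 -> dotF a a = 0 ->
  exists v i, [/\ redp v = a, exists m, dot v v = p%:Z ^+ 2 * m & exists s r, s * v 0 i + r * p%:Z = 1].
Proof.
move=> a0 aa; have [i ai] : exists i, a 0 i != 0.
  apply/existsP; apply: contraNT a0; rewrite negb_exists => /forallP no_i.
  by apply/eqP/rowP => i; rewrite mxE; apply/eqP; have := no_i i; rewrite negbK.
have [v vE] := redp_surj a; have vi : (v 0 i)%:~R = a 0 i by rewrite -vE mxE.
have [c cE] : exists c, dot v v = p%:Z * c by apply: intr_Fp_dvd; rewrite -dotF_redp vE.
have [t tE] := intr_Fp_surj (- c%:~R / (2 * a 0 i)).
exists (v + p%:Z *: (t *: delta_mx 0 i)), i; split.
- by rewrite redpD redp_p addr0.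
- have [m mE] : exists m, c + 2 * t * v 0 i = p%:Z * m.
    apply: intr_Fp_dvd; rewrite rmorphD !rmorphM /= tE vi.
    by field; rewrite ai (two_neq0 p_pr p_gt2).
  exists (m + t ^+ 2); rewrite dotDl !dotDr !dotZl !dotZr cE (dotC _ v) !dot_delta mxE !eqxx /=.
  by rewrite mulr1n mulr1 mulrDr expr2 -[_ * _ * m]mulrA -mE; ring.
have [s sE] := intr_Fp_surj (a 0 i)^-1.
have [r rE] : exists r, 1 - s * v 0 i = p%:Z * r.
  by apply: intr_Fp_dvd; rewrite rmorphB rmorphM /= sE vi mulVf // subrr.
exists s, (r - s * t); rewrite !mxE !eqxx /= mulr1n mulr1 -(subrK (s * v 0 i) 1) rE; ring.
Qed.

(* A decidable form of [neighbour] that depends only on the reduction of [v], valid on vectors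
   whose norm is divisible by [p^2]. *)
Definition in_neighbour (a : 'rV[F]_5) (y : 'rV[int]_5) :=
  [exists k, redp y == k *: a] &&
  ((redp y == 0) ==> (dotF a (redp (map_mx (divz^~ p%:Z) y)) == 0)).

Lemma divp_scale n (z : 'rV[int]_n) : map_mx (divz^~ p%:Z) (p%:Z *: z) = z.
Proof. by apply/rowP => i; rewrite !mxE mulKz. Qed.

Lemma in_neighbourP v y : redp v != 0 -> (exists m, dot v v = p%:Z ^+ 2 * m) ->
  (exists m, dot y y = p%:Z ^+ 2 * m) -> in_neighbour (redp v) y <-> neighbour p%:Z v y.
Proof.
move=> v0 [n vv] [l yy]; split=> [/andP[/existsP[k /eqP yk] /implyP y0]|[[k [z yE]] [m mE]]].
  have [k0 k0E] := intr_Fp_surj k.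
  have [z zE] : exists z, y - k0 *: v = p%:Z *: z.
    by apply: redp_eq0; rewrite -scaleNr redpD redpZ yk rmorphN /= k0E scaleNr subrr.
  have yE : y = k0 *: v + p%:Z *: z by rewrite -zE addrC subrK.
  split; first by exists k0, z.
  have [yr0|yr0] := eqVneq (redp y) 0.
    have [w wE] := redp_eq0 yr0; move: (y0 (introT eqP yr0)).
    rewrite wE divp_scale dotF_redp => /eqP/intr_Fp_dvd[m mE].
    by exists m; rewrite dotZr mE mulrA.
  have k_neq0 : k != 0 by apply: contraNneq yr0 => k0'; rewrite yk k0' scale0r.
  (* Mod [p^2] the norm of [k0 v + p z] is [2 k0 p (v.z)], so [p] divides [v.z]. *)
  have [m mE] : exists m, dot v z = p%:Z * m.
    apply: intr_Fp_dvd; apply: (mulfI k_neq0); apply: (mulfI two_Fp_neq0); rewrite !mulr0 -k0E -!rmorphM /=.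
    apply/eqP; rewrite intr_Fp_eq0; apply/dvdzP; exists (l - k0 ^+ 2 * n - dot z z).
    apply: (mulfI p_neq0); move: yy; rewrite yE dotDl !dotDr !dotZl !dotZr vv (dotC z v) => yy.
    transitivity (p%:Z ^+ 2 * l - k0 * (k0 * (p%:Z ^+ 2 * n)) - p%:Z * (p%:Z * dot z z)); last ring.
    by rewrite -yy; ring.
  by exists (k0 * n + m); rewrite yE dotDr !dotZr vv mE; ring.
apply/andP; split; first by apply/existsP; exists k%:~R; rewrite yE redpD redp_p addr0 redpZ.
apply/implyP => /eqP /redp_eq0[w wE]; rewrite wE divp_scale dotF_redp.
rewrite intr_Fp_eq0; apply/dvdzP; exists m; apply: (mulfI p_neq0).
by rewrite -dotZr -wE mE; ring.
Qed.

Definition cone := [set a : 'rV[F]_5 | (a != 0) && (dotF a a == 0)].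

(** [u -> u B] multiplies norms by [p^2] and maps Z^5 onto the scaled neighbour. *)
Lemma count_in_neighbour a n : a \in cone ->
  count (in_neighbour a) (reps 5 (p ^ 2 * n)) = size (reps 5 n).
Proof.
rewrite inE => /andP[a0 /eqP aa]; have [v [i [va vv vi]]] := isotropic_lift a0 aa.
have p_gt0 : 0 < p%:Z by have := prime_gt0 p_pr; lia.
have [B BB nB] := neighbour_basis p_gt0 vv vi.
have normB u : norm2 (u *m B) = p%:Z ^+ 2 * norm2 u.
  by rewrite !norm2_dot /dot trmx_mul mulmxA -(mulmxA u) BB mul_mx_scalar -scalemxAl mx11Z.
have p2E : (p ^ 2 * n)%N%:Z = p%:Z ^+ 2 * n%:Z by rewrite PoszM; congr (_ * _); lia.
have p2_neq0 : p%:Z ^+ 2 != 0 by rewrite expf_neq0.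
rewrite -size_filter -(size_map (mulmx^~ B) (reps 5 n)); apply/perm_size/uniq_perm.
- by rewrite filter_uniq // reps_uniq.
- rewrite map_inj_uniq ?reps_uniq // => x y /(congr1 (mulmx^~ B^T)).
  by rewrite -!mulmxA BB !mul_mx_scalar => /(scalemx_int_inj p2_neq0).
move=> y; rewrite mem_filter mem_reps -va; apply/andP/mapP => [[iy /eqP yn]|[u]].
  have /nB[u uE] : neighbour p%:Z v y.
    by apply/in_neighbourP; rewrite ?va //; [exists n%:Z; rewrite -norm2_dot yn|rewrite -va].
  exists u => //; rewrite mem_reps; apply/eqP/(mulfI p2_neq0).
  by rewrite -normB -uE yn.
rewrite mem_reps => /eqP un ->; split; last by rewrite normB un p2E.
apply/in_neighbourP => //; first by rewrite va.
  by exists n%:Z; rewrite -norm2_dot normB un.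
by apply/nB; exists u.
Qed.

Lemma card_cone_line (b : 'rV[F]_5) : b \in cone ->
  #|[set a in cone | [exists k, b == k *: a]]| = p.-1.
Proof.
rewrite inE => /andP[b0 /eqP bb].
have inj : injective (fun k : F => k *: b).
  move=> k l /eqP; rewrite -subr_eq0 -scalerBl => /eqP kl; apply/eqP; rewrite -subr_eq0.
  apply: contraNT b0 => kl0; apply/eqP; rewrite -[b]scale1r -(mulVf kl0) -scalerA kl scaler0 //.
have <- : #|[set~ (0 : F)]| = p.-1 by rewrite cardsC1 card_F.
rewrite -(card_imset _ inj); apply: eq_card => a; rewrite !inE.
apply/andP/imsetP => [[/andP[a0 _] /existsP[k /eqP bE]]|[k]].
  have k0 : k != 0 by apply: contraNneq b0 => k0; rewrite bE k0 scale0r.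
  exists k^-1; first by rewrite !inE invr_eq0.
  by rewrite bE scalerA mulVf // scale1r.
rewrite !inE => k0 ->; split.
  rewrite dotFZl dotFZr bb !mulr0 eqxx andbT; apply: contraNneq b0 => kb.
  by rewrite -[b]scale1r -(mulVf k0) -scalerA kb scaler0.
by apply/existsP; exists k^-1; rewrite scalerA mulVf // scale1r.
Qed.

Lemma card_cone : #|cone| = (p ^ 4).-1.
Proof.
have in0 : 0 \in [set a : 'rV[F]_5 | dotF a a == 0] by rewrite inE /dotF mul0mx mxE.
rewrite -(card_isotropic p_pr p_gt2) [in RHS](cardsD1 0) in0 add1n /=.
by apply: eq_card => a; rewrite !inE.
Qed.

Lemma card_cone_orth (z : 'rV[F]_5) : z \in cone -> #|[set a in cone | dotF a z == 0]| = (p ^ 3).-1.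
Proof.
rewrite inE => /andP[z0 /eqP zz]; rewrite -(card_isotropic_orth p_pr p_gt2 z0 zz).
have in0 : 0 \in [set a : 'rV[F]_5 | (dotF a a == 0) && (dotF a z == 0)].
  by rewrite inE /dotF !mul0mx mxE.
rewrite [in RHS](cardsD1 0) in0 add1n /=.
by apply: eq_card => a; rewrite !inE andbA.
Qed.

(** [p %| n] makes the reduction of [y] isotropic, and that of [y / p] when [y] vanishes mod [p].
    The [a] counted are multiples of the former or orthogonal to the latter. *)
Lemma count_neighbours_of n y : (p %| n)%N -> y \in reps 5 (p ^ 2 * n) ->
  #|[set a in cone | in_neighbour a y]| =
  if redp y != 0 then p.-1
  else if redp (map_mx (divz^~ p%:Z) y) == 0 then (p ^ 4).-1 else (p ^ 3).-1.
Proof.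
move=> pn; rewrite mem_reps => /eqP yn.
have nm : (n%:Z%:~R : F) = 0 by apply/eqP; rewrite intr_Fp_eq0.
have [y0|y0] /= := eqVneq (redp y) 0; last first.
  rewrite -(card_cone_line (b := redp y)); last first.
    by rewrite inE y0 dotF_redp -norm2_dot yn PoszM rmorphM /= nm mulr0 eqxx.
  by apply: eq_card => a; rewrite !inE /in_neighbour (negPf y0) /= andbT.
have [z zE] := redp_eq0 y0; rewrite zE divp_scale.
have zn : norm2 z = n.
  have p2_neq0 : p%:Z ^+ 2 != 0 by rewrite expf_neq0.
  apply: (mulfI p2_neq0); move: yn; rewrite zE !norm2_dot dotZl dotZr mulrA -expr2 => ->.
  by rewrite PoszM; congr (_ * _); lia.
have inE' a : in_neighbour a (p%:Z *: z) = (dotF a (redp z) == 0).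
  rewrite /in_neighbour divp_scale redp_p eqxx /=; case: existsP => // -[].
  by exists 0; rewrite scale0r.
have [z0|z0] := eqVneq (redp z) 0.
  rewrite -card_cone; apply: eq_card => a; rewrite !inE inE' z0.
  by rewrite {2}/dotF trmx0 mulmx0 mxE eqxx andbT.
rewrite -(card_cone_orth (z := redp z)); last first.
  by rewrite inE z0 dotF_redp -norm2_dot zn nm eqxx.
by apply: eq_card => a; rewrite !inE inE'.
Qed.

Lemma reps5_redp0_perm n :
  perm_eq [seq y <- reps 5 (p ^ 2 * n) | redp y == 0] [seq p%:Z *: z | z <- reps 5 n].
Proof.
have p2_neq0 : p%:Z ^+ 2 != 0 by rewrite expf_neq0.
apply: uniq_perm; first by rewrite filter_uniq // reps_uniq.
  by rewrite map_inj_uniq ?reps_uniq // => x y /(scalemx_int_inj p_neq0).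
move=> y; rewrite mem_filter mem_reps; apply/andP/mapP => [[/eqP/redp_eq0[z ->] yn]|[z]].
  exists z => //; rewrite mem_reps; apply/eqP/(mulfI p2_neq0); move: yn.
  by rewrite !norm2_dot dotZl dotZr mulrA -expr2 PoszM => /eqP->; congr (_ * _); lia.
rewrite mem_reps => /eqP zn ->; rewrite redp_p eqxx norm2_dot dotZl dotZr -norm2_dot zn.
by split=> //; apply/eqP; rewrite PoszM mulrA; congr (_ * _); lia.
Qed.

Lemma count_redp0 n : count (fun y => redp y == 0) (reps 5 (p ^ 2 * n)) = size (reps 5 n).
Proof. by rewrite -size_filter (perm_size (reps5_redp0_perm n)) size_map. Qed.

Lemma count_redp0_eq0 n : ~~ (p ^ 2 %| n)%N -> count (fun y => redp y == 0) (reps 5 n) = 0%N.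
Proof.
move=> p2n; apply/eqP; rewrite -leqn0 leqNgt -has_count; apply/hasPn => y.
rewrite mem_reps => /eqP yn; apply: contraNN p2n => /eqP/redp_eq0[z zE].
have : (p%:Z ^+ 2 %| n%:Z)%Z by rewrite -yn zE norm2_dot dotZl dotZr mulrA dvdz_mulr.
by rewrite dvdzE abszX.
Qed.

Lemma reps5_hecke n : (p %| n)%N ->
  (size (reps 5 (p ^ 2 * n)) + p ^ 3 * count (fun z => redp z == 0%R) (reps 5 n) =
  (p ^ 3 + 1) * size (reps 5 n))%N.
Proof.
move=> pn; set r0 := count _ _; set r := size (reps 5 n); set r2 := size _.
(* The pairs [(a, y)] summed over [a] first. *)
have total : ((p ^ 4).-1 * r = \sum_(y <- reps 5 (p ^ 2 * n)) #|[set a in cone | in_neighbour a y]|)%N.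
  rewrite -card_cone -sum_nat_const.
  transitivity (\sum_(a in cone) \sum_(y <- reps 5 (p ^ 2 * n)) in_neighbour a y)%N.
    apply: eq_bigr => a ac; rewrite /r -(count_in_neighbour n ac) -sum1_count big_mkcond /=.
    by apply: eq_bigr => y _; case: ifP.
  rewrite exchange_big /=; apply: eq_bigr => y _.
  rewrite -sum1dep_card big_mkcondr /=; apply: eq_bigr => a _; by case: ifP.
have perm := reps5_redp0_perm n; have count0 := count_redp0 n; rewrite -/r in count0.
(* The same pairs by [y]: those not divisible by [p], those divisible by [p^2], and those divisible
   by [p] only. *)
have : ((p ^ 4).-1 * r = (r2 - r) * p.-1 + (r0 * (p ^ 4).-1 + (r - r0) * (p ^ 3).-1))%N.
  rewrite total (bigID (fun y => redp y == 0)) /= addnC; congr (_ + _)%N.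
    rewrite big_seq_cond (eq_bigr (fun=> p.-1)) => [|y /andP[yr y0]]; last first.
      by rewrite (count_neighbours_of pn yr) y0.
    rewrite -big_seq_cond sum_const_count; congr (_ * _)%N.
    by rewrite -count0 /r2 -(count_predC (fun y => redp y == 0)) addKn.
  rewrite -big_filter (perm_big _ perm) /= big_map big_seq.
  rewrite (eq_bigr (fun z => if redp z == 0 then (p ^ 4).-1 else (p ^ 3).-1)) => [|z zr]; last first.
    rewrite (count_neighbours_of pn) ?redp_p ?eqxx ?divp_scale //.
    by have := map_f (fun z => p%:Z *: z) zr; rewrite -(perm_mem perm) mem_filter => /andP[].
  rewrite -big_seq (bigID (fun z => redp z == 0)) /=; congr (_ + _)%N.
    by rewrite (eq_bigr (fun=> (p ^ 4).-1)) ?sum_const_count // => z ->.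
  rewrite (eq_bigr (fun=> (p ^ 3).-1)) ?sum_const_count => [|z /negPf-> //].
  by rewrite /r -(count_predC (fun z => redp z == 0)) addKn.
have r0r : (r0 <= r)%N by apply: count_size.
have rr2 : (r <= r2)%N by rewrite -count0 count_size.
have [d rE] : exists d, r = (r0 + d)%N by exists (r - r0)%N; lia.
have [e r2E] : exists e, r2 = (r + e)%N by exists (r2 - r)%N; lia.
(* The double count has the common factor [k = p - 1]. *)
have [k pE] : exists k, p = k.+1 by exists p.-1; have := prime_gt0 p_pr; lia.
rewrite r2E addKn {2}rE addKn rE pE.
have -> : (k.+1 ^ 4).-1 = (k * (k.+1 ^ 3 + k.+1 ^ 2 + k.+1 + 1))%N by rewrite !expnS expn0; nia.
have -> : (k.+1 ^ 3).-1 = (k * (k.+1 ^ 2 + k.+1 + 1))%N by rewrite !expnS expn0; nia.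
have k0 : (0 < k)%N by lia.
move=> E; apply/eqP; rewrite -(eqn_pmul2l k0); apply/eqP; move: E; rewrite /= !expnS expn0; nia.
Qed.

(** With [r_k] the number of representations of [p^(2k+1) N], the Hecke relation makes
    [r_(k+1) - p^3 r_k] independent of [k]. It starts at [r_0] because [p^2] does not divide
    [p N]. *)
Lemma reps5_odd_powers N k : coprime N p ->
  (size (reps 5 (p ^ (2 * k.+1).+1 * N)) =
   p ^ 3 * size (reps 5 (p ^ (2 * k).+1 * N)) + size (reps 5 (p * N)))%N.
Proof.
move=> cNp; have p0 := prime_gt0 p_pr.
have step j : (p ^ (2 * j.+1).+1 * N = p ^ 2 * (p ^ (2 * j).+1 * N))%N.
  by rewrite mulnA -expnD; congr (p ^ _ * N)%N; lia.
have pdvd j : (p %| p ^ (2 * j).+1 * N)%N by rewrite expnS -mulnA dvdn_mulr.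
elim: k => [|k IHk].
  have := reps5_hecke (pdvd 0%N); rewrite -step count_redp0_eq0; last first.
    rewrite expn1 expnS dvdn_pmul2l // expn1 -prime_coprime //; first by rewrite coprime_sym.
  by rewrite muln0 addn0 => ->; rewrite mulnDl mul1n expn1.
have := reps5_hecke (pdvd k.+1); rewrite -step [in count _ _]step count_redp0.
by rewrite mulnDl mul1n; move: IHk; lia.
Qed.
End Hecke.

(** * Congruences for overpartitions from the recurrence for five squares *)

Lemma overpartition_3n_dvd d n : (d %| 9)%N -> (d %| size (reps 5 n))%N ->
  (overpartition_count (3 * n) %% d = 0)%N.
Proof.
move=> d9 dr; apply/eqP; have := overpartition_3n_mod9 n.
move=> /eqP; rewrite eqz_mod_dvd => n9.
have : (d%:Z %| (-1) ^+ n * (overpartition_count (3 * n))%:R)%Z.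
  rewrite -[X in (_ %| X)%Z](subrK (size (reps 5 n))%:R) rpredD //; last by rewrite natz dvdzE.
  by apply: dvdz_trans n9; rewrite dvdzE.
by rewrite dvdzE natz abszMsign.
Qed.
Local Close Scope ring_scope.

Theorem theorem6 (p N alpha : nat) :
  prime p -> 3 <= p -> 0 < N -> coprime N p ->
  (p %% 3 = 1 ->
     overpartition_count (3 * p ^ (6 * alpha + 5) * N) %% 3 = 0 /\
     overpartition_count (3 * p ^ (18 * alpha + 17) * N) %% 9 = 0) /\
  (p %% 3 = 2 ->
     overpartition_count (3 * p ^ (4 * alpha + 3) * N) %% 9 = 0).
Proof.
move=> p_pr p3 _ cNp.
pose r k := size (reps 5 (p ^ (2 * k).+1 * N)).
have rS k : r k.+1 = p ^ 3 * r k + r 0.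
  by rewrite /r (reps5_odd_powers p_pr p3 k cNp) expn1.
have conclude d e k : e = (2 * k).+1 -> d %| 9 -> d %| r k ->
    overpartition_count (3 * p ^ e * N) %% d = 0.
  by move=> -> d9 drk; rewrite -mulnA; apply: overpartition_3n_dvd.
have p9 c : p ^ 3 %% 9 = c -> forall x, exists y, p ^ 3 * x = 9 * y + c * x.
  by move=> <- x; exists (p ^ 3 %/ 9 * x); rewrite {1}(divn_eq (p ^ 3) 9); lia.
have [q [s [pE s3]]] : exists q s, p = 3 * q + s /\ s < 3.
  by exists (p %/ 3), (p %% 3); lia.
split=> p_mod.
  (* [p^3 = 1] mod 9 gives [r k = (k + 1) r 0] mod 9; the two exponents make [k + 1] equal to
     [3 (alpha + 1)] and [9 (alpha + 1)]. *)
  have c1 : p ^ 3 %% 9 = 1.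
    have -> : p ^ 3 = 9 * (3 * q ^ 3 + 3 * q ^ 2 + q) + 1.
      by rewrite (_ : p = 3 * q + 1); [rewrite !expnS expn0; nia|lia].
    by rewrite mulnC modnMDl.
  have rk k : exists y, r k = 9 * y + k.+1 * r 0.
    elim: k => [|k [y yE]]; first by exists 0; lia.
    by have [z zE] := p9 _ c1 (r k); exists (z + y); rewrite rS zE yE; lia.
  split.
    have [y yE] := rk (3 * alpha + 2); apply: (conclude _ _ (3 * alpha + 2)) => //; first lia.
    by apply/dvdnP; exists (3 * y + alpha.+1 * r 0); rewrite yE; lia.
  have [y yE] := rk (9 * alpha + 8); apply: (conclude _ _ (9 * alpha + 8)) => //; first lia.
  by apply/dvdnP; exists (y + alpha.+1 * r 0); rewrite yE; lia.
(* Now [p^3 = -1] mod 9, so [r k] vanishes mod 9 for odd [k], in steps of two: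
   [r (k + 2) = 64 r k + 9 r 0] mod 9. *)
have c8 : p ^ 3 %% 9 = 8.
  have -> : p ^ 3 = 9 * (3 * q ^ 3 + 6 * q ^ 2 + 4 * q) + 8.
    by rewrite (_ : p = 3 * q + 2); [rewrite !expnS expn0; nia|lia].
  by rewrite mulnC modnMDl.
apply: (conclude _ _ (2 * alpha + 1)) => //; first lia.
elim: alpha => [|a IHa].
  by have [z zE] := p9 _ c8 (r 0); apply/dvdnP; exists (z + r 0); rewrite rS zE; lia.
have [y yE] := dvdnP IHa.
have [z zE] := p9 _ c8 (r (2 * a + 1)); have [z' zE'] := p9 _ c8 (r (2 * a + 1).+1).
have -> : 2 * a.+1 + 1 = (2 * a + 1).+2 by lia.
apply/dvdnP; exists (z' + 8 * z + 64 * y + r 0); rewrite rS zE' rS zE yE; lia.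
Qed.
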